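(* Let $n\ge 1$ and $0\le k,m\le n$ be integers, and let $\lambda$ be a partition with at most $k$ parts not exceeding $n-k$ and $\mu$ a partition with at most $m$ parts not exceeding $n-m$. There exists a subvariety (slice) $S\subset X^\circ_\lambda\times X^\circ_\mu$ such that: (i) $S$ is isomorphic to an affine space of dimension $\dim S=d(\mathrm{Id},\lambda,\mu)$; that is, $\dim S$ equals the codimension of $\mathcal O^{\min}_{\lambda\mu}$ in $X^\circ_\lambda\times X^\circ_\mu$; (ii) $S$ intersects each orbit closure $\overline{\mathcal O^w_{\lambda\mu}}$, $w\in\mathcal I_n(\lambda,\mu)$, transversally; in particular, $S\cap\mathcal O^{\min}_{\lambda\mu}$ is a single point; (iii) there exists an embedding $\imath\colon S\hookrightarrow\mathcal X_n$ such that for each $w\in\mathcal I_n(\lambda,\mu)$ we have $$\imath(\mathcal O^w_{\lambda\mu}\cap S)\subseteq B\cdot w_<.$$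
   Context: Everything is over $\mathbb C$. $B\subset \mathrm{GL}_n(\mathbb C)$ is the subgroup of invertible upper-triangular matrices, and $e_1,\dots,e_n$ is the standard basis of $\mathbb C^n$. $\mathcal I_n=\{w\in \mathcal S_n\mid w^2=\mathrm{Id}\}$ is the set of involutive permutations of $\{1,\dots,n\}$ (including the identity). $\mathcal X_n$ is the variety of strictly upper-triangular complex $n\times n$ matrices $X$ with $X^2=0$; $B$ acts on it by conjugation. For $w\in\mathcal I_n$, $w_<\in\mathcal X_n$ is the matrix with $(w_<)_{ij}=1$ if $w(i)=j$ and $i<j$, and $(w_<)_{ij}=0$ otherwise; $B\cdot w_<$ is its orbit under conjugation. $\mathrm{Gr}(k,n)$ is the Grassmannian of $k$-dimensional subspaces of $\mathbb C^n$. Write $\lambda=(\lambda_1\ge\dots\ge\lambda_k\ge 0)$ with $\lambda_1\le n-k$, and $\mu=(\mu_1\ge\dots\ge\mu_m\ge0)$ with $\mu_1\le n-m$. Let $U_\lambda=\langle e_{\lambda_k+1},e_{\lambda_{k-1}+2},\dots,e_{\lambda_1+k}\rangle$ and let $X^\circ_\lambda=B\cdot U_\lambda\subset \mathrm{Gr}(k,n)$ be the Schubert cell; similarly $X^\circ_\mu\subset\mathrm{Gr}(m,n)$. $B$ acts diagonally on $\mathrm{Gr}(k,n)\times\mathrm{Gr}(m,n)$, preserving $X^\circ_\lambda\times X^\circ_\mu$. Let $s_i(\lambda)=1$ if $i\in\{\lambda_k+1,\lambda_{k-1}+2,\dots,\lambda_1+k\}$ and $s_i(\lambda)=0$ otherwise;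 define $s_i(\mu)$ in the same way using $\{\mu_m+1,\mu_{m-1}+2,\dots,\mu_1+m\}$; set $s_i(\lambda,\mu)=s_i(\lambda)+s_i(\mu)\in\{0,1,2\}$ for $1\le i\le n$. The set $\mathcal I_n(\lambda,\mu)\subseteq\mathcal I_n$ consists of all $w\in\mathcal I_n$ such that for every pair $i<j$ with $w(i)=j$ one has $s_i(\lambda,\mu)=0$ and $s_j(\lambda,\mu)=2$. For $w\in\mathcal I_n(\lambda,\mu)$, $\mathcal O^w_{\lambda\mu}\subseteq X^\circ_\lambda\times X^\circ_\mu$ is the $B$-orbit of the pair $(U,W)$ with $$U=\langle e_j\mid s_j(\lambda)=1,\ w(j)=j\rangle+\langle e_{w(j)}+e_j\mid s_j(\lambda)=1,\ w(j)\ne j\rangle,\qquad W=\langle e_{\mu_m+1},e_{\mu_{m-1}+2},\dots,e_{\mu_1+m}\rangle.$$ Known: $w\mapsto\mathcal O^w_{\lambda\mu}$ is a bijection from $\mathcal I_n(\lambda,\mu)$ to the set of $B$-orbits in $X^\circ_\lambda\times X^\circ_\mu$. $\mathcal O^{\min}_{\lambda\mu}=\mathcal O^{\mathrm{Id}}_{\lambda\mu}$ is the unique minimal orbit (for inclusion of orbit closures), and $d(\mathrm{Id},\lambda,\mu)=\#\{(i,j)\mid 1\le i<j\le n,\ s_i(\lambda,\mu)=0,\ s_j(\lambda,\mu)=2\}$. Transversality of $S$ to an orbit closure (which may be singular) is understood as transversality of $S$ to the $B$-orbits: at every $p\in S\cap\mathcal O$, for $\mathcal O$ a $B$-orbit in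 $X^\circ_\lambda\times X^\circ_\mu$, the tangent spaces $T_pS$ and $T_p\mathcal O$ together span $T_p(X^\circ_\lambda\times X^\circ_\mu)$. An embedding is a morphism of varieties that is an isomorphism onto a (locally closed) subvariety. *)

(* Defs.v *)
From HB Require Import structures.
From mathcomp Require Import all_boot all_order all_algebra all_fingroup.
From mathcomp Require Import boolp classical_sets reals.
From mathcomp Require Import complex mpoly.

Set Implicit Arguments.
Unset Strict Implicit.
Unset Printing Implicit Defensive.

Import GRing.Theory.

Local Open Scope ring_scope.
Local Open Scope classical_set_scope.

(* Varieties in the classical sense: spaces with functions (over an *)
(* algebraically closed field) and their locally closed subsets with the *)
(* induced, reduced structure. *)
(* [sregular U f] is only meant for open [U]; the values of [f] outside [U] *)
(* are junk. *)
Record fspace (K : fieldType) := Fspace {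
  fsort :> Type;
  sopen : set (set fsort);
  sregular : set fsort -> set (fsort -> K) }.

(* Polynomial functions, without a choice of coordinates: polynomial *)
(* expressions in finitely many linear forms. *)
Definition polyfun (K : closedFieldType) (V : vectType K) (f : V -> K) : Prop :=
  exists (r : nat) (l : 'I_r -> {linear V -> K^o}) (P : {mpoly K[r]}),
    forall x, f x = P.@[fun i => l i x].

Definition zariski_open (K : closedFieldType) (V : vectType K) (U : set V)
    : Prop :=
  exists2 P : set (V -> K), P `<=` @polyfun K V &
    U = [set x | exists2 f, P f & f x != 0].

Definition zariski_regular (K : closedFieldType) (V : vectType K) (U : set V)
    (f : V -> K) : Prop :=
  forall p, U p -> exists g h, [/\ polyfun g, polyfun h, h p != 0 &
    forall x, U x -> h x != 0 -> f x = g x / h x].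

Definition affine_space (K : closedFieldType) (V : vectType K) : fspace K :=
  @Fspace K V (@zariski_open K V) (@zariski_regular K V).

Definition locally_closed (K : fieldType) (X : fspace K) (A : set X) : Prop :=
  exists U V : set X, [/\ sopen U, sopen V & A = U `&` ~` V].

Definition zclosure (K : fieldType) (X : fspace K) (A : set X) : set X :=
  [set x | forall U : set X, sopen U -> U x -> U `&` A !=set0].

(* [f] is regular on the subset [A `&` U] of the subvariety [A]: locally it *)
(* is the restriction of a regular function of the ambient space. *)
Definition regular_on (K : fieldType) (X : fspace K) (A U : set X) (f : X -> K)
    : Prop :=
  forall p, A p -> U p -> exists (V : set X) (g : X -> K),
    [/\ sopen V, V p, sregular V g &
        forall x, A x -> U x -> V x -> f x = g x].

(* A map between subvarieties is given by a map of the ambient spaces whose *)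
(* values outside [A] are junk. *)
Definition morphism (K : fieldType) (X Y : fspace K) (A : set X) (B : set Y)
    (f : X -> Y) : Prop :=
  [/\ forall x, A x -> B (f x),
      forall V : set Y, sopen V ->
        exists2 U : set X, sopen U & A `&` f @^-1` V = A `&` U &
      forall (V : set Y) (g : Y -> K), sopen V -> sregular V g ->
        regular_on A (f @^-1` V) (g \o f)].

Definition isomorphism (K : fieldType) (X Y : fspace K) (A : set X) (B : set Y)
    (f : X -> Y) : Prop :=
  morphism A B f /\ exists g : Y -> X, [/\ morphism B A g,
    forall x, A x -> g (f x) = x & forall y, B y -> f (g y) = y].

Definition isomorphic (K : fieldType) (X Y : fspace K) (A : set X) (B : set Y)
    : Prop :=
  exists f : X -> Y, isomorphism A B f.

Definition embedding (K : fieldType) (X Y : fspace K) (A : set X) (B : set Y)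
    (f : X -> Y) : Prop :=
  exists T : set Y, [/\ T `<=` B, locally_closed T & isomorphism A T f].

(* Dimension as transcendence degree: the largest number of algebraically *)
(* independent regular functions on a nonempty open subset. *)
Definition has_indep_functions (K : closedFieldType) (X : fspace K) (A : set X)
    (r : nat) : Prop :=
  exists (U : set X) (f : 'I_r -> X -> K),
    [/\ sopen U, A `&` U !=set0, forall i, regular_on A U (f i) &
        forall P : {mpoly K[r]},
          (forall x, A x -> U x -> P.@[fun i => f i x] = 0) -> P = 0].

Definition has_dim (K : closedFieldType) (X : fspace K) (A : set X) (r : nat)
    : Prop :=
  has_indep_functions A r /\
  forall r', has_indep_functions A r' -> (r' <= r)%N.

Definition has_codim (K : closedFieldType) (X : fspace K) (A B : set X)
    (c : nat) : Prop :=
  exists N e : nat, [/\ has_dim B N, has_dim A e & N = (e + c)%N].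

Definition regular_at (K : fieldType) (X : fspace K) (p : X) (f : X -> K)
    : Prop :=
  exists U : set X, [/\ sopen U, U p & sregular U f].

(* Tangent vectors are point derivations of the local ring at [p]. *)
(* The value of a derivation on functions not regular at [p] is junk. *)
Definition derivation_at (K : fieldType) (X : fspace K) (p : X)
    (D : (X -> K) -> K) : Prop :=
  [/\ forall f g, regular_at p f -> regular_at p g ->
        (exists U : set X, [/\ sopen U, U p & forall x, U x -> f x = g x]) ->
        D f = D g,
      forall f g, regular_at p f -> regular_at p g ->
        D (fun x => f x + g x) = D f + D g,
      forall c f, regular_at p f -> D (fun x => c * f x) = c * D f &
      forall f g, regular_at p f -> regular_at p g ->
        D (fun x => f x * g x) = f p * D g + g p * D f].

(* The tangent space of the (reduced) subvariety [A], inside that of [X]. *)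
Definition tangent_space (K : fieldType) (X : fspace K) (A : set X) (p : X)
    : set ((X -> K) -> K) :=
  [set D | derivation_at p D /\
    forall f, regular_at p f ->
      (exists U : set X,
         [/\ sopen U, U p & forall x, A x -> U x -> f x = 0]) ->
      D f = 0].

(* T_p S + T_p O = T_p A, for subvarieties S and O of A. *)
Definition transverse_at (K : fieldType) (X : fspace K) (A S O : set X) (p : X)
    : Prop :=
  forall D, tangent_space A p D ->
    exists D1 D2, [/\ tangent_space S p D1, tangent_space O p D2 &
      forall f, regular_at p f -> D f = D1 f + D2 f].

Definition colspan (K : fieldType) (n k : nat) (A : 'M[K]_(n, k))
    : {vspace 'cV[K]_n} :=
  limg (linfun (mulmx A : 'cV[K]_k -> 'cV[K]_n)).

Definition frames (K : fieldType) (n k m : nat)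
    : set ('M[K]_(n, k) * 'M[K]_(n, m)) :=
  [set A | \rank A.1 = k /\ \rank A.2 = m].
Arguments frames : clear implicits.

Definition span_pair (K : fieldType) (n k m : nat)
    (A : 'M[K]_(n, k) * 'M[K]_(n, m))
    : {vspace 'cV[K]_n} * {vspace 'cV[K]_n} :=
  (colspan A.1, colspan A.2).

(* The disjoint union over all k and m of the varieties Gr(k,n) x Gr(m,n): *)
(* a point is an arbitrary pair of subspaces.  On each piece the structure *)
(* is that of the quotient by GL_k x GL_m of the open set of pairs of *)
(* frames (matrices with independent columns). *)
Definition grass2 (K : closedFieldType) (n : nat) : fspace K :=
  @Fspace K ({vspace 'cV[K]_n} * {vspace 'cV[K]_n})%type
    (fun U => forall k m : nat,
       zariski_open (frames K n k m `&` @span_pair K n k m @^-1` U))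
    (fun U f => forall k m : nat,
       zariski_regular (frames K n k m `&` @span_pair K n k m @^-1` U)
         (f \o @span_pair K n k m)).

Definition borel (K : fieldType) (n : nat) : set 'M[K]_n :=
  [set b | b \in unitmx /\ forall i j : 'I_n, (j < i)%N -> b i j = 0].
Arguments borel : clear implicits.

Definition act (K : fieldType) (n : nat) (b : 'M[K]_n) (U : {vspace 'cV[K]_n})
    : {vspace 'cV[K]_n} :=
  (linfun (mulmx b : 'cV[K]_n -> 'cV[K]_n) @: U)%VS.

Definition orbit2 (K : closedFieldType) (n : nat) (p : grass2 K n)
    : set (grass2 K n) :=
  [set q | exists2 b, borel K n b & q = (act b p.1, act b p.2)].

Definition conj_orbit (K : closedFieldType) (n : nat) (M : 'M[K]_n)
    : set (affine_space 'M[K]_n) :=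
  [set N : 'M[K]_n | exists2 b, borel K n b & N = b *m M *m invmx b].

Definition partition_in (n k : nat) (la : k.-tuple nat) : Prop :=
  sorted geq la /\ all (fun x => (x <= n - k)%N) la.

(* { la_k + 1, la_(k-1) + 2, ..., la_1 + k }, shifted by one since 'I_n is *)
(* {0, ..., n - 1}. *)
Definition jumps (n k : nat) (la : k.-tuple nat) : {set 'I_n} :=
  [set i : 'I_n | [exists r : 'I_k,
     (i : nat) == (tnth la (rev_ord r) + r)%N]]%SET.

Definition basis_vec (K : fieldType) (n : nat) (i : 'I_n) : 'cV[K]_n :=
  delta_mx i 0.
Arguments basis_vec K {n} i.

Definition coord_space (K : fieldType) (n : nat) (J : {set 'I_n})
    : {vspace 'cV[K]_n} :=
  (\sum_(j in J) <[basis_vec K j]>)%VS.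
Arguments coord_space K {n} J.

Definition schubert_cell (K : fieldType) (n k : nat) (la : k.-tuple nat)
    : set {vspace 'cV[K]_n} :=
  [set U | exists2 b, borel K n b & U = act b (coord_space K (jumps n la))].
Arguments schubert_cell K n {k} la _.

Definition cell2 (K : closedFieldType) (n k m : nat)
    (la : k.-tuple nat) (mu : m.-tuple nat) : set (grass2 K n) :=
  [set p | schubert_cell K n la p.1 /\ schubert_cell K n mu p.2].
Arguments cell2 K n {k m} la mu _.

Definition s_sum (n k m : nat) (la : k.-tuple nat) (mu : m.-tuple nat)
    (i : 'I_n) : nat :=
  ((i \in jumps n la) + (i \in jumps n mu))%N.

(* d(Id, la, mu) *)
Definition dId (n k m : nat) (la : k.-tuple nat) (mu : m.-tuple nat) : nat :=
  #|[set p : 'I_n * 'I_n |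
      [&& (p.1 < p.2)%N, s_sum la mu p.1 == 0%N & s_sum la mu p.2 == 2%N]]%SET|.

Definition inv_set (n k m : nat) (la : k.-tuple nat) (mu : m.-tuple nat)
    : set 'S_n :=
  [set w : 'S_n | (w * w = 1)%g /\
    forall i j : 'I_n, (i < j)%N -> w i = j ->
      s_sum la mu i = 0%N /\ s_sum la mu j = 2%N].

Definition orbit_rep (K : fieldType) (n k : nat) (la : k.-tuple nat) (w : 'S_n)
    : {vspace 'cV[K]_n} :=
  (\sum_(j in jumps n la | w j == j) <[basis_vec K j]>
   + \sum_(j in jumps n la | w j != j)
       <[basis_vec K (w j) + basis_vec K j]>)%VS.
Arguments orbit_rep K {n k} la w.

Definition orbit_w (K : closedFieldType) (n k m : nat)
    (la : k.-tuple nat) (mu : m.-tuple nat) (w : 'S_n) : set (grass2 K n) :=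
  orbit2 ((orbit_rep K la w, coord_space K (jumps n mu)) : grass2 K n).
Arguments orbit_w K {n k m} la mu w _.

(* The matrix w_< *)
Definition upper_part (K : fieldType) (n : nat) (w : 'S_n) : 'M[K]_n :=
  \matrix_(i, j) ((w i == j) && (i < j)%N)%:R.
Arguments upper_part K {n} w.

(* The variety of strictly upper-triangular matrices of square zero *)
Definition nilp2 (K : closedFieldType) (n : nat) : set (affine_space 'M[K]_n) :=
  [set M : 'M[K]_n |
    (forall i j : 'I_n, (j <= i)%N -> M i j = 0) /\ M *m M = 0].
Arguments nilp2 : clear implicits.

(* Main.v *)
Require Import Defs.
From HB Require Import structures.
From mathcomp Require Import all_boot all_order all_algebra all_fingroup.
From mathcomp Require Import boolp classical_sets reals.
From mathcomp Require Import complex mpoly.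

Set Implicit Arguments.
Unset Strict Implicit.
Unset Printing Implicit Defensive.

Import GRing.Theory.

Local Open Scope ring_scope.
Local Open Scope classical_set_scope.

(** Let [J], [J'] be the sets of jumps of the two partitions, [U0], [W0] the
    coordinate subspaces that they span.  A pair of subspaces in the product of
    the two Schubert cells can be written in a unique way as
    [((1 + u) U0, (1 + u) (1 + v) W0)] with [u], [v] strictly upper triangular,
    [u] supported on the rows outside [J] and the columns in [J], and [v]
    likewise for [J'].  The entries of [u] and [v] are regular functions on an
    open set of the variety of pairs, so that the cell is an affine space
    ([cell_slice]), and so is every set obtained by freezing some of the
    coordinates ([slice_iso], [slice_dim]).

    Call special the entries of [v] above the diagonal in a row outside [J] and
    [J'] and a column in both; they are as many as the claimed dimension.  The
    slice [S] is given by [u = 0] and by the vanishing of the entries of [v] that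
    are not special: its points are the pairs [(U0, (1 + y) W0)] with all nonzero
    entries of [y] special.  Such a [y] has square zero, and the embedding sends
    the pair to [- y].

    Two computations carry the proof.

    If an upper-triangular [b] maps the pair of [y] to the pair with coordinates
    [(0, v)], the special part of [v] is conjugate to [y] under an
    upper-triangular matrix written down explicitly ([slice_conjugacy]).  The orbit indexed by [w]
    contains the point of [S] with [y = - w_<], hence a point of [S] in this
    orbit goes to the orbit of [w_<].  For [y = 0] it follows that the special
    coordinates vanish on the minimal orbit.

    Conversely, if [u] and the non-special part [v] are prescribed, the product
    [(1 + u) (1 + v)] is upper triangular and moves the point of [S] with matrix
    [y] to the pair with coordinates [(u, v + y)] ([slice_orbit]).  Every orbit
    in the cell is thus invariant under translation in the non-special
    coordinates.  In particular
    the minimal orbit is the set where the special coordinates vanish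
    ([min_orbit]), which gives its codimension.  Moreover [S] and the orbit
    through one of its points contain complementary coordinate subspaces of the
    cell, which is transversality ([slice_transverse]).

    The dimension of a parametrized set is found by bounding the number of
    independent rational functions in [e] variables by [e]
    ([algebraic_dependence], [chart_dim]). *)

(** * Polynomials over an algebraically closed field *)

Lemma base_expansion_inj (b n : nat) (f g : 'I_n -> nat) :
  (forall i, (f i < b)%N) -> (forall i, (g i < b)%N) ->
  (\sum_i f i * b ^ i = \sum_i g i * b ^ i)%N -> f =1 g.
Proof.
elim: n f g => [|n IHn] f g fb gb; first by move=> _ [].
rewrite !big_ord_recl !expn0 !muln1.
have tailE (h : 'I_n.+1 -> nat) :
    (\sum_(i < n) h (lift ord0 i) * b ^ lift ord0 i =
     (\sum_(i < n) h (lift ord0 i) * b ^ i) * b)%N.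
  by rewrite big_distrl; apply: eq_bigr => i _; rewrite /= -mulnA -expnSr.
rewrite !tailE => eqfg i.
have b_gt0 : (0 < b)%N by apply: leq_ltn_trans (fb ord0).
have eq0 : f ord0 = g ord0.
  have := congr1 (modn^~ b) eqfg.
  by rewrite !(addnC _ (_ * b)%N) !modnMDl !modn_small.
case: (unliftP ord0 i) => [j ->|-> //].
apply: (IHn (fun j => f (lift ord0 j)) (fun j => g (lift ord0 j))) => //.
move/eqP: eqfg; rewrite eq0 eqn_add2l eqn_pmul2r //.
by move/eqP.
Qed.

Section PolynomialFunctions.
Variable K : closedFieldType.

(** Kronecker substitution: putting [t ^ (b ^ i)] for the [i]-th variable, with
    [b] larger than every exponent, sends distinct monomials to distinct powers
    of [t], so that one nonzero polynomial in [t] remains. *)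
Lemma mpoly_nonzero_value n (P : {mpoly K[n]}) :
  P != 0 -> exists x : 'I_n -> K, P.@[x] != 0.
Proof.
move=> Pn0; pose b := msize P.
pose code (m : 'X_{1..n}) := (\sum_(i < n) m i * b ^ i)%N.
pose Q : {poly K} := \sum_(m <- msupp P) P@_m *: 'X^(code m).
have small m i : m \in msupp P -> (m i < b)%N.
  move=> /msize_mdeg_lt; apply: leq_ltn_trans.
  by rewrite mdegE (bigD1 i) //= leq_addr.
have Qn0 : Q != 0.
  suff: Q`_(code (mlead P)) != 0 by apply: contraNneq => ->; rewrite coef0.
  rewrite coef_sum (bigD1_seq (mlead P)) ?msupp_uniq ?mlead_supp //=.
  rewrite coefZ coefXn eqxx mulr1 big1_seq ?addr0 ?mleadc_eq0 // => m.
  move=> /andP[mP ms]; rewrite coefZ coefXn.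
  case: eqP => [eqc|]; last by rewrite mulr0.
  case/eqP: mP; apply/mnmP => i; symmetry; move: i.
  apply: (base_expansion_inj (b := b) _ _ eqc) => j; apply: small => //.
  exact: mlead_supp.
have /closed_nonrootP [t] := Qn0; rewrite /root => tQ.
exists (fun i => t ^+ (b ^ i)); apply: contra tQ => /eqP Pt0.
rewrite /Q horner_sum -[X in _ == X]Pt0 mevalE; apply/eqP/eq_bigr => m _.
rewrite hornerZ hornerXn; congr (_ * _); rewrite /code -prodrXr.
by apply: eq_bigr => i _; rewrite mulnC exprM.
Qed.

Lemma mpoly_ext n (P : {mpoly K[n]}) : (forall x, P.@[x] = 0) -> P = 0.
Proof.
move=> P0; apply/eqP/negPn/negP => /mpoly_nonzero_value[x].
by rewrite P0 eqxx.
Qed.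

Lemma msizeM_leq n (p q : {mpoly K[n]}) a b :
  (msize p <= a.+1 -> msize q <= b.+1 -> msize (p * q) <= (a + b).+1)%N.
Proof.
have [->|p0] := eqVneq p 0; first by rewrite mul0r msize0.
have [->|q0] := eqVneq q 0; first by rewrite mulr0 msize0.
move=> pa qb; rewrite msizeM //; apply: leq_trans (_ : (a.+1 + b.+1).-1 <= _)%N.
  by rewrite -!subn1 leq_sub2r // leq_add.
by rewrite addnS.
Qed.

Lemma msizeX_leq n (p : {mpoly K[n]}) a k :
  (msize p <= a.+1 -> msize (p ^+ k) <= (k * a).+1)%N.
Proof.
move=> pa; elim: k => [|k IHk]; first by rewrite expr0 msize1.
by rewrite exprS mulSn; apply: msizeM_leq.
Qed.

(** At most [e] rational functions in [e] variables are independent, by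
    counting.  There are [D ^ r] monomials with exponents below [D] in the [r]
    fractions; cleared of denominators they all become polynomials of degree
    linear in [D], which span a space of dimension of order [D ^ e].  Hence they
    are linearly dependent as soon as [e < r] and [D] is large. *)
Lemma algebraic_dependence (e r : nat) (G : 'I_r -> {mpoly K[e]})
    (h : {mpoly K[e]}) : (e < r)%N ->
  exists2 P : {mpoly K[r]}, P != 0 &
    forall y, h.@[y] != 0 -> P.@[fun i => (G i).@[y] / h.@[y]] = 0.
Proof.
move=> ltre.
pose d := (\sum_i msize (G i) + msize h)%N.
have Gd i : (msize (G i) <= d.+1)%N.
  by rewrite /d (bigD1 i) //= -!addnA ltnW // ltnS leq_addr.
have hd : (msize h <= d.+1)%N by rewrite ltnW // ltnS leq_addl.
(* [b ^ e] is at most [D ^ e * (r * d).+1 ^ e], and [D] exceeds the second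
   factor. *)
pose D := ((r * d).+1 ^ e).+1; pose b := (r * (D * d)).+1.
pose Q (s : {ffun 'I_r -> 'I_D}) := \prod_i (G i ^+ s i * h ^+ (D - s i)).
have Qb s : (msize (Q s) <= b)%N.
  rewrite /Q /b -[X in (X * _)%N]card_ord -sum_nat_const.
  elim/big_ind2: _ => [|p a q c|i _]; first by rewrite msize1.
    exact: msizeM_leq.
  have -> : (D * d = s i * d + (D - s i) * d)%N.
    by rewrite -mulnDl subnKC // ltnW.
  by apply: msizeM_leq; apply: msizeX_leq.
pose A := \matrix_(a < #|{ffun 'I_r -> 'I_D}|, m < #|{: 'X_{1..e < b}}|)
   (Q (enum_val a))@_(enum_val m).
have card_lt : (#|{: 'X_{1..e < b}}| < #|{ffun 'I_r -> 'I_D}|)%N.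
  rewrite card_ffun !card_ord.
  have le1 : (#|{: 'X_{1..e < b}}| <= b ^ e)%N.
    pose f (m : 'X_{1..e < b}) := [ffun i => inord (bmnm m i) : 'I_(r * (D * d)).+1].
    have := @leq_card _ _ f; rewrite card_ffun !card_ord; apply => m1 m2.
    move=> /ffunP eqf; apply/val_inj/mnmP => i; have := eqf i.
    have small (m : 'X_{1..e < b}) : (bmnm m i < b)%N.
      by apply: leq_ltn_trans (bmdeg m); rewrite mdegE (bigD1 i) //= leq_addr.
    by rewrite !ffunE => /(congr1 val); rewrite /= !inordK.
  apply: leq_ltn_trans le1 _; apply: leq_trans (_ : D ^ e.+1 <= _)%N; last first.
    by rewrite leq_pexp2l.
  apply: leq_ltn_trans (_ : (D * (r * d).+1) ^ e < _)%N.
    have [->//|e0] := posnP e; rewrite leq_exp2r // /b mulnS mulnCA -add1n.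
    by rewrite leq_add2r.
  by rewrite expnMn expnS mulnC ltn_pmul2r ?expn_gt0.
have : kermx A != 0.
  by rewrite kermx_eq0 neq_ltn (leq_ltn_trans (rank_leq_col A) card_lt).
case/rowV0Pn => a /sub_kermxP aA /rV0Pn[s0 as0].
pose mon (s : {ffun 'I_r -> 'I_D}) : 'X_{1..r} := [multinom (s i : nat) | i < r].
have mon_inj : injective mon.
  move=> s t /mnmP eqm; apply/ffunP => i; apply: val_inj.
  by have := eqm i; rewrite !mnmE.
exists (\sum_s a 0 (enum_rank s) *: 'X_[mon s]).
  apply: contraNneq as0 => /(congr1 (mcoeff (mon (enum_val s0)))).
  rewrite mcoeff0 raddf_sum /= (bigD1 (enum_val s0)) //= mcoeffZ mcoeffX eqxx.
  rewrite enum_valK mulr1 big1 ?addr0 => [->//|s ss0].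
  by rewrite mcoeffZ mcoeffX (inj_eq mon_inj) (negPf ss0) mulr0.
move=> y hy; pose v i := (G i).@[y] / h.@[y].
rewrite -/v raddf_sum /=.
have QE s : (Q s).@[y] = h.@[y] ^+ (D * r) * ('X_[mon s]).@[v].
  rewrite /Q rmorph_prod /= mevalX exprM.
  rewrite -[X in _ ^+ X](card_ord r) -prodr_const -big_split /=.
  apply: eq_bigr => i _; rewrite mnmE mevalM !rmorphXn /= exprMn exprVn.
  have -> : h.@[y] ^+ D = h.@[y] ^+ s i * h.@[y] ^+ (D - s i).
    by rewrite -exprD subnKC // ltnW.
  by rewrite mulrAC mulrCA mulfV ?expf_neq0 // mulr1.
have Q0 : \sum_s a 0 (enum_rank s) *: Q s = 0.
  apply/mpolyP => m; rewrite mcoeff0 raddf_sum /=.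
  have [mb|mb] := ltnP (mdeg m) b; last first.
    rewrite big1 // => s _; rewrite mcoeffZ memN_msupp_eq0 ?mulr0 //.
    by apply: msize_mdeg_ge; apply: leq_trans mb.
  have := congr1 (fun B : 'rV_ _ => B 0 (enum_rank (BMultinom mb))) aA.
  rewrite !mxE => aAm; rewrite -[RHS]aAm.
  rewrite (reindex _ (onW_bij _ (@enum_rank_bij {ffun 'I_r -> 'I_D}))) /=.
  by apply: eq_bigr => s _; rewrite mcoeffZ mxE !enum_rankK.
suff: h.@[y] ^+ (D * r) *
    (\sum_s (a 0 (enum_rank s) *: 'X_[mon s]).@[v]) = 0.
  by move/eqP; rewrite mulf_eq0 expf_eq0 (negPf hy) andbF => /eqP.
rewrite -[RHS](@meval0 e K y) -Q0 raddf_sum /= mulr_sumr.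
by apply: eq_bigr => s _; rewrite !mevalZ QE mulrCA.
Qed.

End PolynomialFunctions.

(** * Polynomial functions and their fractions *)

Section Polyfun.
Variable K : closedFieldType.

(** Closure under sums and products gives a principle by which properties of
    polynomial functions are proved without mentioning linear forms or
    polynomials again. *)
Lemma polyfun_ind (V : vectType K) (Q : (V -> K) -> Prop) :
  (forall c, Q (fun=> c)) -> (forall l : {linear V -> K^o}, Q l) ->
  (forall f g, Q f -> Q g -> Q (fun x => f x + g x)) ->
  (forall f g, Q f -> Q g -> Q (fun x => f x * g x)) ->
  forall f, polyfun f -> Q f.
Proof.
move=> Qc Ql Qa Qm f [r [l [P fE]]].
have -> : f = (fun x => P.@[fun i => l i x]) by apply/funext.
elim/mpolyind: P {fE} => [|c m p _ _ IHp].
  rewrite (_ : (fun _ => _) = fun=> 0); first exact: Qc.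
  by apply/funext => x; rewrite meval0.
have Qprod : Q (fun x => \prod_(i < r) l i x ^+ m i).
  have Qexp i k : Q (fun x => l i x ^+ k).
    elim: k => [|k IHk]; first exact: (Qc 1).
    rewrite (_ : (fun _ => _) = fun x => l i x * l i x ^+ k); first exact: Qm.
    by apply/funext => x; rewrite exprS.
  elim: (index_enum _) => [|i s IHs].
    rewrite (_ : (fun _ => _) = fun=> 1); first exact: Qc.
    by apply/funext => x; rewrite big_nil.
  rewrite (_ : (fun _ => _) =
    fun x => l i x ^+ m i * \prod_(j <- s) l j x ^+ m j); first exact: Qm.
  by apply/funext => x; rewrite big_cons.
rewrite (_ : (fun _ => _) = fun x => c * (\prod_(i < r) l i x ^+ m i) +
  p.@[fun i => l i x]); first by apply: Qa => //; apply: Qm.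
by apply/funext => x; rewrite mevalD mevalZ mevalX.
Qed.

Section Closure.
Variable V : vectType K.
Implicit Types f g : V -> K.

Lemma polyfun_cst c : polyfun (fun _ : V => c).
Proof.
have l : 'I_0 -> {linear V -> K^o} by case.
by exists 0%N, l, c%:MP => x; rewrite mevalC.
Qed.

Lemma polyfun_linear (l : V -> K) : linear (l : V -> K^o) -> polyfun l.
Proof.
move=> l_lin.
pose L := HB.pack_for {linear V -> K^o} (l : V -> K^o)
  (GRing.isLinear.Build K V K^o *:%R (l : V -> K^o) l_lin).
by exists 1%N, (fun=> L), 'X_ord0 => x; rewrite mevalXU.
Qed.

Lemma polyfun_op (op : forall n, {mpoly K[n]} -> {mpoly K[n]} -> {mpoly K[n]})
    (kop : K -> K -> K) f g :
  (forall n x (P Q : {mpoly K[n]}), (op n P Q).@[x] = kop P.@[x] Q.@[x]) ->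
  polyfun f -> polyfun g -> polyfun (fun x => kop (f x) (g x)).
Proof.
move=> opE [r [l [P fE]]] [s [m [Q gE]]].
pose P' := P \mPo [tuple 'X_(lshift s i) | i < r].
pose Q' := Q \mPo [tuple 'X_(rshift r i) | i < s].
exists (r + s)%N, (fun i => match fintype.split i with inl j => l j | inr j => m j end).
exists (op _ P' Q') => x; rewrite opE fE gE /P' /Q' !comp_mpoly_meval.
congr (kop _ _); apply: meval_eq => i; rewrite tnth_mktuple mevalXU.
  by case: splitP => [j /= /val_inj -> //|j /= ij]; have := ltn_ord i; rewrite ij ltnNge leq_addr.
case: splitP => [j /= ij|j /= /addnI /val_inj -> //].
by have := ltn_ord j; rewrite -ij ltnNge leq_addr.
Qed.

Lemma polyfunD f g : polyfun f -> polyfun g -> polyfun (fun x => f x + g x).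
Proof. by apply: (polyfun_op (op := fun _ => +%R)) => *; rewrite mevalD. Qed.

Lemma polyfunM f g : polyfun f -> polyfun g -> polyfun (fun x => f x * g x).
Proof. by apply: (polyfun_op (op := fun _ => *%R)) => *; rewrite mevalM. Qed.

Lemma polyfunN f : polyfun f -> polyfun (fun x => - f x).
Proof.
move=> pf; rewrite (_ : (fun _ => _) = fun x => -1 * f x).
  by apply: polyfunM => //; apply: polyfun_cst.
by apply/funext => x; rewrite mulN1r.
Qed.

Lemma polyfun_sum (I : Type) (s : seq I) (F : I -> V -> K) :
  (forall i, polyfun (F i)) -> polyfun (fun x => \sum_(i <- s) F i x).
Proof.
move=> pF; elim: s => [|i s IHs].
  rewrite (_ : (fun _ => _) = fun=> 0); first exact: polyfun_cst.
  by apply/funext => x; rewrite big_nil.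
rewrite (_ : (fun _ => _) = fun x => F i x + \sum_(j <- s) F j x).
  exact: polyfunD.
by apply/funext => x; rewrite big_cons.
Qed.

Lemma polyfun_prod (I : Type) (s : seq I) (F : I -> V -> K) :
  (forall i, polyfun (F i)) -> polyfun (fun x => \prod_(i <- s) F i x).
Proof.
move=> pF; elim: s => [|i s IHs].
  rewrite (_ : (fun _ => _) = fun=> 1); first exact: polyfun_cst.
  by apply/funext => x; rewrite big_nil.
rewrite (_ : (fun _ => _) = fun x => F i x * \prod_(j <- s) F j x).
  exact: polyfunM.
by apply/funext => x; rewrite big_cons.
Qed.

Definition polymx (a b : nat) (F : V -> 'M[K]_(a, b)) : Prop :=
  forall i j, polyfun (fun x => F x i j).

Lemma polymx_cst a b (A : 'M[K]_(a, b)) : polymx (fun=> A).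
Proof. by move=> i j; apply: polyfun_cst. Qed.

Lemma polymxD a b (F G : V -> 'M[K]_(a, b)) :
  polymx F -> polymx G -> polymx (fun x => F x + G x).
Proof.
move=> pF pG i j; rewrite (_ : (fun _ => _) = fun x => F x i j + G x i j).
  exact: polyfunD.
by apply/funext => x; rewrite mxE.
Qed.

Lemma polymxN a b (F : V -> 'M[K]_(a, b)) :
  polymx F -> polymx (fun x => - F x).
Proof.
move=> pF i j; rewrite (_ : (fun _ => _) = fun x => - F x i j).
  exact: polyfunN.
by apply/funext => x; rewrite mxE.
Qed.

Lemma polymxM a b c (F : V -> 'M[K]_(a, b)) (G : V -> 'M[K]_(b, c)) :
  polymx F -> polymx G -> polymx (fun x => F x *m G x).
Proof.
move=> pF pG i j; rewrite (_ : (fun _ => _) = fun x => \sum_l F x i l * G x l j).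
  by apply: polyfun_sum => l; apply: polyfunM.
by apply/funext => x; rewrite mxE.
Qed.

Lemma polymx_scalar a f : polyfun f -> polymx (fun x => (f x)%:M : 'M[K]_a).
Proof.
move=> pf i j; rewrite (_ : (fun _ => _) = fun x => (i == j)%:R * f x).
  by apply: polyfunM => //; apply: polyfun_cst.
by apply/funext => x; rewrite mxE mulr_natl.
Qed.

Lemma polyfun_det a (F : V -> 'M[K]_a) : polymx F -> polyfun (fun x => \det (F x)).
Proof.
move=> pF; apply: (@polyfun_sum _ _ (fun (s : 'S_a) x =>
  (-1) ^+ s * \prod_i F x i (s i))) => s.
by apply: polyfunM; [apply: polyfun_cst|apply: polyfun_prod].
Qed.

Lemma polymx_adj a (F : V -> 'M[K]_a) : polymx F -> polymx (fun x => \adj (F x)).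
Proof.
move=> pF i j; rewrite (_ : (fun _ => _) = fun x => cofactor (F x) j i); last first.
  by apply/funext => x; rewrite mxE.
apply: polyfunM; first exact: polyfun_cst.
apply: (@polyfun_det _ (fun x => row' j (col' i (F x)))) => r s.
rewrite (_ : (fun _ => _) = fun x => F x (lift j r) (lift i s)); first exact: pF.
by apply/funext => x; rewrite !mxE.
Qed.

End Closure.

(** The functions that are regular at [p] on the subset [U]; [zariski_regular U]
    asks for this at every point of [U].  Fixing the point makes these functions
    a ring in which division by a function not vanishing at [p] is possible. *)
Definition fraction_at (V : vectType K) (U : set V) (f : V -> K) (p : V) : Prop :=
  exists g h, [/\ polyfun g, polyfun h, h p != 0 &
    forall x, U x -> h x != 0 -> f x = g x / h x].

Section Fractions.
Variables (V : vectType K) (U : set V) (p : V).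
Implicit Types f g : V -> K.

Lemma fraction_at_poly f : polyfun f -> fraction_at U f p.
Proof.
move=> pf; exists f, (fun=> 1); split; rewrite ?oner_eq0 //.
  exact: polyfun_cst.
by move=> x _ _; rewrite divr1.
Qed.

Lemma fraction_atD f g : fraction_at U f p -> fraction_at U g p ->
  fraction_at U (fun x => f x + g x) p.
Proof.
move=> [a [b [pa pb bp fE]]] [c [d [pc pd dp gE]]].
exists (fun x => a x * d x + c x * b x), (fun x => b x * d x).
split; [|exact: polyfunM|by rewrite mulf_neq0|].
  by apply: polyfunD; apply: polyfunM.
move=> x Ux; rewrite mulf_eq0 negb_or => /andP[bx dx].
by rewrite fE // gE // addf_div.
Qed.

Lemma fraction_atM f g : fraction_at U f p -> fraction_at U g p ->
  fraction_at U (fun x => f x * g x) p.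
Proof.
move=> [a [b [pa pb bp fE]]] [c [d [pc pd dp gE]]].
exists (fun x => a x * c x), (fun x => b x * d x).
split; [exact: polyfunM|exact: polyfunM|by rewrite mulf_neq0|].
move=> x Ux; rewrite mulf_eq0 negb_or => /andP[bx dx].
by rewrite fE // gE // mulf_div.
Qed.

Lemma fraction_at_div f g h : U p -> fraction_at U f p -> fraction_at U g p ->
  g p != 0 -> (forall x, U x -> g x != 0 -> h x = f x / g x) ->
  fraction_at U h p.
Proof.
move=> Up [a [b [pa pb bp fE]]] [c [d [pc pd dp gE]]] gp hE.
exists (fun x => a x * d x * d x), (fun x => b x * c x * d x).
split; [by do 2![apply: polyfunM => //]|by do 2![apply: polyfunM => //]| |].
  rewrite !mulf_neq0 //; apply: contraNneq gp => cp.
  by rewrite gE // cp mul0r.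
move=> x Ux; rewrite !mulf_eq0 !negb_or => /andP[/andP[bx cx] dx].
have gx : g x != 0 by rewrite gE // mulf_neq0 ?invr_eq0.
by rewrite hE // fE // gE // invf_div mulf_div -[RHS]mulf_div divff // mulr1.
Qed.

Lemma fraction_at_comp (W : vectType K) (c : V -> W) (q : W -> K) :
  (forall l : {linear W -> K^o}, fraction_at U (l \o c) p) ->
  polyfun q -> fraction_at U (q \o c) p.
Proof.
move=> lc; elim/polyfun_ind: q / => [a|l|f g|f g]; [|exact: lc|exact: fraction_atD|exact: fraction_atM].
by apply: fraction_at_poly; apply: polyfun_cst.
Qed.

End Fractions.

End Polyfun.

(** * The Zariski topology of a vector space *)

Section ZariskiTopology.
Variable K : closedFieldType.

(** Open sets become unions of principal open sets, which is the form in which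
    preimages and intersections are easily computed. *)
Lemma zariski_openP (V : vectType K) (U : set V) : zariski_open U <->
  forall x, U x -> exists f, [/\ polyfun f, f x != 0 & forall y, f y != 0 -> U y].
Proof.
split=> [[P Ppoly ->] x [f Pf fx]|UP].
  by exists f; split=> //; [exact: Ppoly|move=> y fy; exists f].
exists [set f | polyfun f /\ forall y, f y != 0 -> U y]; first by move=> f [].
apply/seteqP; split=> [x /UP[f [pf fx fU]]|x [f [_ fU] /fU//]].
by exists f.
Qed.

Lemma zariski_openI (V : vectType K) (U W : set V) :
  zariski_open U -> zariski_open W -> zariski_open (U `&` W).
Proof.
move=> /zariski_openP oU /zariski_openP oW; apply/zariski_openP.
move=> x [/oU[f [pf fx fU]] /oW[g [pg gx gW]]].
exists (fun y => f y * g y); split; [exact: polyfunM|by rewrite mulf_neq0|].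
by move=> y; rewrite mulf_eq0 negb_or => /andP[/fU Uy /gW].
Qed.

Lemma zariski_open_nonzero (V : vectType K) (f : V -> K) :
  polyfun f -> zariski_open [set x | f x != 0].
Proof. by move=> pf; apply/zariski_openP => x fx; exists f. Qed.

Lemma fraction_at_sub (V : vectType K) (U W : set V) f p :
  W `<=` U -> fraction_at U f p -> fraction_at W f p.
Proof.
by move=> WU [g [h [pg ph hp fE]]]; exists g, h; split=> // x /WU; exact: fE.
Qed.

Definition polymap (V W : vectType K) (F : V -> W) : Prop :=
  forall l : {linear W -> K^o}, polyfun (l \o F).

Section Polymap.
Variables V W : vectType K.
Variables (F : V -> W).
Hypothesis pF : polymap F.

Lemma polyfun_comp f : polyfun f -> polyfun (f \o F).
Proof.
elim/polyfun_ind: f /; [|exact: pF|by move=> f g; exact: polyfunD|by move=> f g; exact: polyfunM].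
by move=> c; apply: polyfun_cst.
Qed.

Lemma zariski_open_preimage U : zariski_open U -> zariski_open (F @^-1` U).
Proof.
move=> /zariski_openP oU; apply/zariski_openP => x /oU[f [pf fx fU]].
exists (f \o F); split=> //; first exact: polyfun_comp.
by move=> y /fU.
Qed.

Lemma zariski_regular_preimage U f :
  zariski_regular U f -> zariski_regular (F @^-1` U) (f \o F).
Proof.
move=> rf x /rf[g [h [pg ph hx fE]]]; exists (g \o F), (h \o F).
by split=> //; [exact: polyfun_comp|exact: polyfun_comp|move=> y /fE].
Qed.

End Polymap.

Lemma linear_mx_sum (a b : nat) (l : {linear 'M[K]_(a, b) -> K^o}) A :
  l A = \sum_i \sum_j A i j * l (delta_mx i j).
Proof.
rewrite {1}[A]matrix_sum_delta linear_sum; apply: eq_bigr => i _.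
by rewrite linear_sum; apply: eq_bigr => j _; rewrite linearZ.
Qed.

Lemma polymap_mx (V : vectType K) (a b : nat) (F : V -> 'M[K]_(a, b)) :
  polymx F -> polymap F.
Proof.
move=> pF l; rewrite (_ : _ \o _ = fun x => \sum_i \sum_j F x i j * l (delta_mx i j)).
  do 2![apply: polyfun_sum => ?]; apply: polyfunM => //; exact: polyfun_cst.
by apply/funext => x; rewrite /= linear_mx_sum.
Qed.

Lemma polymap_mx2 (V : vectType K) (a b c d : nat)
    (F : V -> 'M[K]_(a, b) * 'M[K]_(c, d)) :
  polymx (fun x => (F x).1) -> polymx (fun x => (F x).2) -> polymap F.
Proof.
move=> pF1 pF2 l.
have lin1 : linear (fun A => l (A, 0) : K^o).
  move=> s A B; rewrite -linearP; congr (l _).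
  by apply/pair_equal_spec; rewrite /= scaler0 addr0.
have lin2 : linear (fun A => l (0, A) : K^o).
  move=> s A B; rewrite -linearP; congr (l _).
  by apply/pair_equal_spec; rewrite /= scaler0 addr0.
pose l1 := HB.pack_for {linear 'M[K]_(a, b) -> K^o} (fun A => l (A, 0) : K^o)
  (GRing.isLinear.Build K _ K^o *:%R _ lin1).
pose l2 := HB.pack_for {linear 'M[K]_(c, d) -> K^o} (fun A => l (0, A) : K^o)
  (GRing.isLinear.Build K _ K^o *:%R _ lin2).
rewrite (_ : _ \o _ = fun x => (l1 \o (fst \o F)) x + (l2 \o (snd \o F)) x).
  by apply: polyfunD; apply: polymap_mx.
apply/funext => x /=; rewrite -linearD; congr (l _).
by case: (F x) => A B; apply/pair_equal_spec; rewrite /= addr0 add0r.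
Qed.

Lemma polymx_linear (V : vectType K) a b (F : V -> 'M[K]_(a, b)) :
  linear F -> polymx F.
Proof.
by move=> linF i j; apply: polyfun_linear => s x y; rewrite linF !mxE.
Qed.

Lemma polyfun_rowP (e : nat) (f : 'rV[K]_e -> K) :
  polyfun f <-> exists P : {mpoly K[e]}, forall x, f x = P.@[fun i => x 0 i].
Proof.
split=> [|[P fE]]; last first.
  rewrite (_ : f = fun x => P.@[fun i => x 0 i]); last exact/funext.
  pose l i := HB.pack_for {linear 'rV[K]_e -> K^o} (fun x : 'rV[K]_e => x 0 i : K^o)
    (GRing.isLinear.Build K _ K^o *:%R (fun x : 'rV[K]_e => x 0 i : K^o)
      (fun s x y => etrans (mxE _ _ _ _) (congr1 (fun t => t + y 0 i) (mxE _ _ _ _)))).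
  by exists e, l, P.
elim/polyfun_ind: f / => [c|l|f g [P fE] [Q gE]|f g [P fE] [Q gE]].
- by exists c%:MP => x; rewrite mevalC.
- exists (\sum_i l (delta_mx 0 i) *: 'X_i) => x; rewrite linear_mx_sum big_ord1.
  by rewrite raddf_sum /=; apply: eq_bigr => i _; rewrite mevalZ mevalXU mulrC.
- by exists (P + Q) => x; rewrite mevalD fE gE.
- by exists (P * Q) => x; rewrite mevalM fE gE.
Qed.

End ZariskiTopology.

(** * Charts of the variety of pairs of subspaces *)

Section Grass2.
Variables (K : closedFieldType) (n : nat).
Local Notation X := (grass2 K n).

Lemma grass2_openI (U W : set X) : sopen U -> sopen W -> sopen (U `&` W).
Proof.
move=> oU oW k m; have := zariski_openI (oU k m) (oW k m).
by congr zariski_open; apply/seteqP; split=> A /=; tauto.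
Qed.

Lemma grass2_regular_sub (U W : set X) f :
  W `<=` U -> sregular U f -> sregular W f.
Proof.
move=> WU rf k m A [fA WA].
apply: (@fraction_at_sub _ _ _ _ _ _ _ (rf k m A (conj fA (WU _ WA)))).
by move=> B [fB /WU].
Qed.

Lemma grass2_regularD (U : set X) f g : sregular U f -> sregular U g ->
  sregular U (fun x => f x + g x).
Proof. by move=> rf rg k m A UA; apply: fraction_atD; [exact: rf|exact: rg]. Qed.

Lemma grass2_regularM (U : set X) f g : sregular U f -> sregular U g ->
  sregular U (fun x => f x * g x).
Proof. by move=> rf rg k m A UA; apply: fraction_atM; [exact: rf|exact: rg]. Qed.

Lemma grass2_regular_cst (U : set X) c : sregular U (fun=> c).
Proof. by move=> k m A UA; apply: fraction_at_poly; apply: polyfun_cst. Qed.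

Lemma grass2_regular_sum (I : Type) (s : seq I) (U : set X) (F : I -> X -> K) :
  (forall i, sregular U (F i)) -> sregular U (fun x => \sum_(i <- s) F i x).
Proof.
move=> rF; elim: s => [|i s IHs].
  rewrite (_ : (fun _ => _) = fun=> 0); first exact: grass2_regular_cst.
  by apply/funext => x; rewrite big_nil.
rewrite (_ : (fun _ => _) = fun x => F i x + \sum_(j <- s) F j x).
  exact: grass2_regularD.
by apply/funext => x; rewrite big_cons.
Qed.

Lemma regular_atD (p : X) f g :
  regular_at p f -> regular_at p g -> regular_at p (fun x => f x + g x).
Proof.
move=> [U [oU Up rf]] [W [oW Wp rg]]; exists (U `&` W); split=> //.
  exact: grass2_openI.
by apply: grass2_regularD; [apply: grass2_regular_sub rf|apply: grass2_regular_sub rg] => x [].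
Qed.

Lemma regular_atM (p : X) f g :
  regular_at p f -> regular_at p g -> regular_at p (fun x => f x * g x).
Proof.
move=> [U [oU Up rf]] [W [oW Wp rg]]; exists (U `&` W); split=> //.
  exact: grass2_openI.
by apply: grass2_regularM; [apply: grass2_regular_sub rf|apply: grass2_regular_sub rg] => x [].
Qed.

(** [D 1 = D (1 * 1) = 2 * D 1] forces [D 1 = 0]; an open neighbourhood of [p]
    is needed for the constants to be regular at [p]. *)
Lemma derivation_cst (p : X) (D : (X -> K) -> K) (U : set X) a :
  sopen U -> U p -> derivation_at p D -> D (fun=> a) = 0.
Proof.
move=> oU Up [_ _ DZ DM]; have r1 : regular_at p (fun=> 1 : K).
  by exists U; split=> //; exact: grass2_regular_cst.
have D1 : D (fun=> 1) = 0.
  have := DM _ _ r1 r1; rewrite !mul1r => /eqP.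
  by rewrite -subr_eq0 opprD addNKr oppr_eq0 => /eqP.
by have := DZ a _ r1; rewrite D1 mulr0 mulr1.
Qed.

Section Charts.
Variables (V : vectType K) (k m : nat).
Variables (F : V -> 'M[K]_(n, k) * 'M[K]_(n, m)) (Om : set X) (c : X -> V).
Hypothesis F_poly : polymap F.
Hypothesis F_frames : forall x, frames K n k m (F x).
Hypothesis Om_open : sopen Om.
Hypothesis c_regular : forall l : {linear V -> K^o}, sregular Om (l \o c).

Let phi : V -> X := fun x => span_pair (F x).

Lemma param_open (U : set X) : sopen U -> zariski_open (phi @^-1` U).
Proof.
move=> oU; have := zariski_open_preimage F_poly (oU k m).
congr zariski_open; apply/seteqP; split=> x; first by case.
by move=> Ux; split=> //; exact: F_frames.
Qed.

Lemma param_regular (U : set X) f :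
  sregular U f -> zariski_regular (phi @^-1` U) (f \o phi).
Proof.
move=> rf; have := zariski_regular_preimage F_poly (rf k m).
congr zariski_regular; apply/seteqP; split=> x; first by case.
by move=> Ux; split=> //; exact: F_frames.
Qed.

Lemma chart_poly_regular (q : V -> K) : polyfun q -> sregular Om (q \o c).
Proof.
move=> pq k' m' A OmA; apply: (@fraction_at_comp _ _ _ _ _ (c \o @span_pair K n k' m')) => // l.
exact: (c_regular l (k := k') (m := m') OmA).
Qed.

Lemma chart_open (U : set V) : zariski_open U -> sopen (Om `&` c @^-1` U).
Proof.
move=> /zariski_openP oU k' m'; apply/zariski_openP => A [frA [OmA /= /oU]].
move=> [q [pq qA qU]].
have /zariski_openP/(_ A (conj frA OmA))[f [pf fA fOm]] := Om_open k' m'.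
have [g [h [pg ph hA qE]]] := chart_poly_regular pq (conj frA OmA).
exists (fun B => f B * (g B * h B)); split.
- by do 2![apply: polyfunM => //].
- rewrite !mulf_neq0 //; apply: contraNneq qA => gA.
  by have := qE _ (conj frA OmA) hA; rewrite /= gA mul0r => ->.
- move=> B; rewrite !mulf_eq0 !negb_or => /and3P[/fOm[frB OmB] gB hB].
  split=> //; split=> //=; apply: qU.
  by have /= -> := qE _ (conj frB OmB) hB; rewrite mulf_neq0 ?invr_eq0.
Qed.

Lemma chart_regular (U : set V) (q : V -> K) :
  zariski_regular U q -> sregular (Om `&` c @^-1` U) (q \o c).
Proof.
move=> rq k' m' A [frA [OmA UA]]; have [g [h [pg ph hA qE]]] := rq _ UA.
apply: (@fraction_at_div _ _ _ _ (g \o c \o @span_pair K n k' m') (h \o c \o @span_pair K n k' m')) => //.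
- by apply: fraction_at_sub (chart_poly_regular pg (conj frA OmA)) => B [? []].
- by apply: fraction_at_sub (chart_poly_regular ph (conj frA OmA)) => B [? []].
- by move=> B [_ [_ UB]] hB /=; apply: qE.
Qed.

(** A subvariety parametrized by [phi], with coordinates [c] defined and regular
    on a whole open set of the ambient variety, is isomorphic to the space of
    parameters: both maps are restrictions of ambient regular maps, so no local
    extension of functions has to be found. *)
Lemma chart_iso (T : set V) (A : set X) : A = phi @` T -> A `<=` Om ->
  (forall x, T x -> c (phi x) = x) ->
  isomorphism (K := K) (X := X) (Y := affine_space V) A T c.
Proof.
move=> AE AOm cK; split.
  split=> [p|U oU|U f oU rf p Ap Up].
  - by rewrite AE => -[x Tx <-]; rewrite cK.
  - exists (Om `&` c @^-1` U); first exact: chart_open.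
    apply/seteqP; split=> p [Ap]; first by move=> Up; split=> //; split=> //; exact: AOm.
    by case.
  - exists (Om `&` c @^-1` U), (f \o c); split=> //.
    + exact: chart_open.
    + by split=> //; exact: AOm.
    + exact: chart_regular.
exists phi; split=> [|p|x Tx].
- split=> [x Tx|U oU|U f oU rf x Tx Ux].
  + by rewrite AE; exists x.
  + by exists (phi @^-1` U) => //; exact: param_open.
  + exists (phi @^-1` U), (f \o phi); split=> //; first exact: param_open.
    exact: param_regular.
- by rewrite AE => -[x Tx <-]; rewrite cK.
- exact: cK.
Qed.

Lemma retract_regular (p : X) (f : X -> K) :
  Om p -> phi (c p) = p -> regular_at p f -> regular_at p (f \o phi \o c).
Proof.
move=> Omp fixp [U [oU Up rf]]; exists (Om `&` c @^-1` (phi @^-1` U)); split.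
- exact: chart_open (param_open oU).
- by split=> //=; rewrite fixp.
- exact: chart_regular (param_regular rf).
Qed.

(** Tangent vectors along the slice and along an orbit are produced from one
    tangent vector [D] without computing a differential: a function which
    vanishes on [Z] near [p] becomes zero after composition with the retraction
    [phi \o c], whose image lies in [Z]. *)
Lemma retract_tangent (Z : set X) (p : X) (D : (X -> K) -> K) :
  (forall x, Z (phi x)) -> Om p -> phi (c p) = p -> derivation_at p D ->
  tangent_space Z p (fun f => D (f \o phi \o c)).
Proof.
move=> Zphi Omp fixp [Dext DD DZ DM].
have reg f := @retract_regular p f Omp fixp.
have nbhd (U : set X) : sopen U -> U p ->
    sopen (Om `&` c @^-1` (phi @^-1` U)) /\ (Om `&` c @^-1` (phi @^-1` U)) p.
  by move=> oU Up; split; [exact: chart_open (param_open oU)|split=> //=; rewrite fixp].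
split; [split|].
- move=> f g rf rg [U [oU Up fg]]; apply: Dext; [exact: reg|exact: reg|].
  by have [oV Vp] := nbhd U oU Up; eexists; split; [exact: oV|exact: Vp|move=> x [_ /fg]].
- by move=> f g rf rg; apply: (DD _ _ (reg _ rf) (reg _ rg)).
- by move=> a f rf; apply: (DZ a _ (reg _ rf)).
- by move=> f g rf rg; have := DM _ _ (reg _ rf) (reg _ rg); rewrite /= fixp.
- move=> f rf [U [oU Up f0]]; have r0 : regular_at p (fun=> 0 : K).
    by exists U; split=> //; exact: grass2_regular_cst.
  have /= <- : D (fun x => 0 * 0) = 0 by rewrite (DZ 0 _ r0) mul0r.
  have [oV Vp] := nbhd U oU Up; apply: Dext; [exact: reg|by rewrite mul0r|].
  eexists; split; [exact: oV|exact: Vp|move=> x [_ Ux] /=].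
  by rewrite mul0r; apply: f0.
Qed.

(** A tangent vector is determined by its values on coordinates.  Near [p], a
    regular function [f] agrees on the image of [phi] with a fraction [g / h] of
    polynomials in [c]; hence [D] kills [h(c) f - g(c)], and it kills [g(c)] and
    [h(c)] because it kills linear forms in [c]. *)
Lemma tangent_vector_eq0 (A : set X) (p : X) (D : (X -> K) -> K) :
  A = range phi -> A `<=` Om -> (forall x, c (phi x) = x) -> A p ->
  tangent_space A p D ->
  (forall l : {linear V -> K^o}, D (l \o c) = 0) ->
  forall f, regular_at p f -> D f = 0.
Proof.
move=> AE AOm cK Ap [dD D0] Dl f rf; have [Dext DD DZ DM] := dD.
have Omp : Om p by exact: AOm.
have rq q : polyfun q -> regular_at p (q \o c).
  by move=> pq; exists Om; split=> //; exact: chart_poly_regular.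
have Dq q : polyfun q -> D (q \o c) = 0.
  move=> pq; pose P (q : V -> K) := polyfun q /\ D (q \o c) = 0.
  suff: P q by case.
  elim/polyfun_ind: q / pq => [a|l|g h [pg g0] [ph h0]|g h [pg g0] [ph h0]].
  - split; first exact: polyfun_cst.
    exact: derivation_cst Om_open Omp dD.
  - by split=> //; apply: polyfun_linear; exact: linearP.
  - split; first exact: polyfunD.
    by have := DD _ _ (rq _ pg) (rq _ ph); rewrite g0 h0 addr0.
  - split; first exact: polyfunM.
    by have := DM _ _ (rq _ pg) (rq _ ph); rewrite g0 h0 !mulr0 addr0.
have [U [oU Up sf]] := rf.
have [x px] : exists x, phi x = p by move: Ap; rewrite AE => -[x _ <-]; exists x.
have Ux : (phi @^-1` U) x by rewrite /= px.
have [g [h [pg ph hx fE]]] := param_regular sf Ux.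
have cp : c p = x by rewrite -px cK.
have rhf := regular_atM (rq _ ph) rf.
have rg : regular_at p (fun y => -1 * (g \o c) y).
  have pg' : polyfun (fun x => -1 * g x) by apply: polyfunM => //; apply: polyfun_cst.
  exact: (rq _ pg').
have := D0 _ (regular_atD rhf rg).
rewrite (DD _ _ rhf rg) (DZ _ _ (rq _ pg)) (DM _ _ (rq _ ph) rf) !Dq // !mulr0 !addr0.
rewrite /= cp => H; apply/eqP; have /eqP : h x * D f = 0; last first.
  by rewrite mulf_eq0 (negPf hx).
apply: H; exists (U `&` (Om `&` c @^-1` [set y | h y != 0])); split.
- by apply: grass2_openI => //; apply: chart_open; exact: zariski_open_nonzero.
- by split=> //; split=> //=; rewrite cp.
- move=> q; rewrite AE => -[y _ <-] [Uy [_ /=]]; rewrite cK => hy.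
  have /= -> := fE _ Uy hy; by rewrite mulrC divfK // mulN1r subrr.
Qed.

End Charts.
End Grass2.

(** * Dimension of a set parametrized by a chart *)

Section ChartDimension.
Variables (K : closedFieldType) (n k m e : nat).
Local Notation X := (grass2 K n).
Variables (F : 'rV[K]_e -> 'M[K]_(n, k) * 'M[K]_(n, m)).
Variables (Om : set X) (c : X -> 'rV[K]_e).
Hypothesis F_poly : polymap F.
Hypothesis F_frames : forall x, frames K n k m (F x).
Hypothesis Om_open : sopen Om.
Hypothesis c_regular : forall l : {linear 'rV[K]_e -> K^o}, sregular Om (l \o c).

Let phi : 'rV[K]_e -> X := fun x => span_pair (F x).

Lemma polyfun_coord (i : 'I_e) : polyfun (fun x : 'rV[K]_e => x 0 i).
Proof. by apply/polyfun_rowP; exists 'X_i => x; rewrite mevalXU. Qed.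

(** Irreducibility of affine space: two nonzero polynomials have a nonzero
    product, hence a common point where neither vanishes. *)
Lemma polyfun_row_eq0 (f g : 'rV[K]_e -> K) (x : 'rV[K]_e) :
  polyfun f -> polyfun g -> g x != 0 ->
  (forall y, g y != 0 -> f y = 0) -> forall y, f y = 0.
Proof.
move=> /polyfun_rowP[P fE] /polyfun_rowP[Q gE] gx f0 y.
have : P * Q = 0.
  apply: mpoly_ext => v; pose z : 'rV[K]_e := \row_i v i.
  have zE (R : {mpoly K[e]}) : R.@[v] = R.@[fun i => z 0 i].
    by apply: meval_eq => i; rewrite mxE.
  rewrite mevalM !zE -fE -gE; have [->|gz] := eqVneq (g z) 0; first by rewrite mulr0.
  by rewrite f0 ?mul0r.
move/eqP; rewrite mulf_eq0 => /orP[|] /eqP P0.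
  by rewrite fE P0 meval0.
by move: gx; rewrite gE P0 meval0 eqxx.
Qed.

Lemma regular_on_fraction (A U : set X) f x :
  A = range phi -> regular_on A U f -> U (phi x) ->
  fraction_at (phi @^-1` U) (f \o phi) x.
Proof.
move=> AE rf Ux; have Ax : A (phi x) by rewrite AE; exists x.
have [W [g [oW Wx rg fE]]] := rf _ Ax Ux.
have [a [b [pa pb bx gE]]] := param_regular F_poly F_frames rg Wx.
have /zariski_openP/(_ x Wx)[u [pu ux uW]] := param_open F_poly F_frames oW.
exists (fun y => a y * u y), (fun y => b y * u y); split.
- exact: polyfunM.
- exact: polyfunM.
- by rewrite mulf_neq0.
- move=> y Uy; rewrite mulf_eq0 negb_or => /andP[by0 uy].
  rewrite -mulf_div divff // mulr1 -gE //; last exact: uW.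
  by apply: fE => //; [rewrite AE; exists y|exact: uW].
Qed.

(** The counting argument of [algebraic_dependence] wants a single denominator;
    the product of the given ones serves. *)
Lemma common_denominator (r : nat) (U : set 'rV[K]_e) (f : 'I_r -> 'rV[K]_e -> K) x :
  (forall i, fraction_at U (f i) x) ->
  exists (g : 'I_r -> 'rV[K]_e -> K) h, [/\ forall i, polyfun (g i), polyfun h,
    h x != 0 & forall i y, U y -> h y != 0 -> f i y = g i y / h y].
Proof.
move=> /choice[g /choice[h gh]].
exists (fun i y => g i y * \prod_(j < r | j != i) h j y), (fun y => \prod_j h j y).
split.
- move=> i; apply: polyfunM; first by have [] := gh i.
  rewrite (_ : (fun _ => _) = fun y => \prod_j (if j != i then h j y else 1)).
    apply: polyfun_prod => j; case: (j != i); last exact: polyfun_cst.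
    by have [] := gh j.
  by apply/funext => y; rewrite big_mkcond.
- by apply: polyfun_prod => j; have [] := gh j.
- by apply/prodf_neq0 => j _; have [] := gh j.
- move=> i y Uy; rewrite (bigD1 i) //= mulf_eq0 negb_or => /andP[hi hr].
  by have [_ _ _ ->] := gh i; rewrite // -mulf_div divff // mulr1.
Qed.

Lemma fraction_at_meval (r : nat) (U : set 'rV[K]_e) (f : 'I_r -> 'rV[K]_e -> K)
    (P : {mpoly K[r]}) x :
  (forall i, fraction_at U (f i) x) ->
  fraction_at U (fun y => P.@[fun i => f i y]) x.
Proof.
move=> /common_denominator[g [h [pg ph hx fE]]].
have : fraction_at U ((fun z : 'rV[K]_r => P.@[fun i => z 0 i]) \o
   (fun y => \row_i f i y)) x.
  apply: fraction_at_comp => [l|]; last by apply/polyfun_rowP; exists P.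
  exists (fun y => \sum_i g i y * l (delta_mx 0 i)), h; split=> //.
    apply: polyfun_sum => i; apply: polyfunM => //; exact: polyfun_cst.
  move=> y Uy hy /=; rewrite linear_mx_sum big_ord1 mulr_suml.
  by apply: eq_bigr => i _; rewrite mxE fE // mulrAC.
congr fraction_at; apply/funext => y /=; apply: meval_eq => i; by rewrite mxE.
Qed.

(** The coordinates [c] are algebraically independent.  Conversely any family
    of regular functions becomes, in the coordinates, a family of rational
    functions in [e] variables; a polynomial relation between them near one
    point holds everywhere since affine space is irreducible. *)
Lemma chart_dim (A : set X) :
  A = range phi -> A `<=` Om -> (forall x, c (phi x) = x) -> has_dim A e.
Proof.
move=> AE AOm cK; split.
  exists Om, (fun i p => c p 0 i); split=> //.
  - exists (phi 0); split; first by rewrite AE; exists 0.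
    by apply: AOm; rewrite AE; exists 0.
  - move=> i p _ Omp; exists Om, (fun p => c p 0 i); split=> //.
    exact: (chart_poly_regular c_regular (polyfun_coord i)).
  - move=> P P0; apply: mpoly_ext => v; pose x : 'rV[K]_e := \row_i v i.
    have Ax : A (phi x) by rewrite AE; exists x.
    rewrite -(P0 (phi x)) //; last exact: AOm.
    by apply: meval_eq => i; rewrite cK mxE.
move=> r [U [f [oU [p [Ap Up]] rf indep]]]; rewrite leqNgt; apply/negP => ltre.
have frac x : U (phi x) -> forall i, fraction_at (phi @^-1` U) (f i \o phi) x.
  by move=> Ux i; apply: (regular_on_fraction AE).
have [x0 px0] : exists x, phi x = p by move: Ap; rewrite AE => -[x _ <-]; exists x.
have Ux0 : U (phi x0) by rewrite px0.
have [g [h [pg ph hx0 fE]]] := common_denominator (frac _ Ux0).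
have /zariski_openP/(_ x0 Ux0)[u [pu ux0 uU]] := param_open F_poly F_frames oU.
have /choice [G gE] : forall i, exists P : {mpoly K[e]}, forall x, g i x = P.@[fun j => x 0 j].
  by move=> i; apply/polyfun_rowP.
have /polyfun_rowP[H hE] := ph.
have [P P0 PG] := algebraic_dependence G H ltre.
move/eqP: P0; apply; apply: indep => q; rewrite AE => -[x1 _ <-] Ux1.
have [a [b [pa pb bx1 abE]]] := fraction_at_meval P (frac _ Ux1).
rewrite (abE x1 Ux1 bx1).
suff -> : a x1 = 0 by rewrite mul0r.
have ab0 : forall y, a y * b y = 0.
  apply: (@polyfun_row_eq0 _ (fun y => h y * u y) x0).
  - exact: polyfunM.
  - exact: polyfunM.
  - by rewrite mulf_neq0.
  - move=> y; rewrite mulf_eq0 negb_or => /andP[hy /uU Uy].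
    have [->|by0] := eqVneq (b y) 0; first by rewrite mulr0.
    have := abE y Uy by0.
    rewrite (_ : P.@[_] = 0); last first.
      rewrite -(PG (fun j => y 0 j)) -?hE //.
      by apply: meval_eq => i; rewrite fE // gE hE.
    by move=> /esym/eqP; rewrite mulf_eq0 invr_eq0 (negPf by0) orbF => /eqP ->; rewrite mul0r.
by have /eqP := ab0 x1; rewrite mulf_eq0 (negPf bx1) orbF => /eqP.
Qed.

End ChartDimension.

(** * Column spaces *)

Local Notation act := Defs.act.

Section ColumnSpaces.
Variables (K : fieldType) (n : nat).

Lemma colspanP k (A : 'M[K]_(n, k)) v :
  reflect (exists x, v = A *m x) (v \in colspan A).
Proof.
apply: (iffP memv_imgP) => [[x _ ->]|[x ->]]; exists x; rewrite ?lfunE ?memvf //=.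
Qed.

Lemma act_colspan k (b : 'M[K]_n) (A : 'M[K]_(n, k)) :
  act b (colspan A) = colspan (b *m A).
Proof.
rewrite /Defs.act /colspan -limg_comp; congr lfun_img; apply/lfunP => x.
by rewrite comp_lfunE !lfunE /= mulmxA.
Qed.

Lemma act_mulmx (b c : 'M[K]_n) U : act b (act c U) = act (b *m c) U.
Proof.
rewrite /Defs.act -limg_comp; congr lfun_img; apply/lfunP => x.
by rewrite comp_lfunE !lfunE /= mulmxA.
Qed.

Lemma act_mx1 U : act (1%:M : 'M[K]_n) U = U.
Proof.
rewrite /Defs.act (_ : linfun _ = \1%VF) ?lim1g //; apply/lfunP => x.
by rewrite !lfunE /= mul1mx.
Qed.

Lemma colspan_sub k l (A : 'M[K]_(n, k)) (B : 'M[K]_(n, l)) :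
  (colspan A <= colspan B)%VS -> exists C, A = B *m C.
Proof.
move=> /subvP AB.
have /choice[x xE] : forall j, exists x, col j A = B *m x.
  move=> j; apply/colspanP/AB/colspanP.
  by exists (delta_mx j 0); rewrite colE.
exists (\matrix_(i, j) x j i 0); apply/matrixP => i j.
have := congr1 (fun C : 'cV_ _ => C i 0) (xE j); rewrite !mxE => ->.
by apply: eq_bigr => l' _; rewrite mxE.
Qed.

Lemma colspan_mulr k l (A : 'M[K]_(n, k)) (C : 'M[K]_(k, l)) :
  (colspan (A *m C) <= colspan A)%VS.
Proof.
by apply/subvP => v /colspanP[x ->]; apply/colspanP; exists (C *m x); rewrite mulmxA.
Qed.

Lemma colspan_mulr_unit k (A : 'M[K]_(n, k)) (g : 'M[K]_k) :
  g \in unitmx -> colspan (A *m g) = colspan A.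
Proof.
move=> gu; apply/eqP; rewrite eqEsubv colspan_mulr /=.
by rewrite -{1}(mulmxK gu A) colspan_mulr.
Qed.

Lemma colspan_rank_le k l (A : 'M[K]_(n, k)) (B : 'M[K]_(n, l)) :
  (colspan A <= colspan B)%VS -> (\rank A <= \rank B)%N.
Proof. by move=> /colspan_sub[C ->]; apply: mxrankM_maxl. Qed.

(** Two frames of the same subspace differ by a change of basis.  Invertibility
    of [C *m A] stands for the independence of the columns of [A], and is what
    the charts provide. *)
Lemma colspan_frame_eq k (A B : 'M[K]_(n, k)) (C : 'M[K]_(k, n)) :
  colspan A = colspan B -> C *m A \in unitmx ->
  exists2 g, g \in unitmx & A = B *m g.
Proof.
move=> AB; have [g ->] : exists g, A = B *m g by apply: colspan_sub; rewrite AB.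
by rewrite mulmxA unitmx_mul => /andP[_ gu]; exists g.
Qed.

Lemma colspan_cols k (A : 'M[K]_(n, k)) :
  colspan A = (\sum_j <[col j A]>)%VS.
Proof.
apply/eqP; rewrite eqEsubv; apply/andP; split.
  apply/subvP => v /colspanP[x ->].
  have -> : A *m x = \sum_j x j 0 *: col j A.
    apply/colP => i; rewrite summxE mxE; apply: eq_bigr => j _.
    by rewrite !mxE mulrC.
  apply: memv_suml => j _; apply: memvZ; apply: (subvP (sumv_sup j _ (subvv _))) => //.
  exact: memv_line.
apply/subv_sumP => j _; rewrite -memvE; apply/colspanP.
by exists (delta_mx j 0); rewrite colE.
Qed.

End ColumnSpaces.

(** * Upper-triangular matrices *)

Section Borel.
Variables (K : fieldType) (n : nat).
Implicit Types b c u : 'M[K]_n.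

Definition upper_mx b := forall i j : 'I_n, (j < i)%N -> b i j = 0.
Definition strict_upper_mx b := forall i j : 'I_n, (j <= i)%N -> b i j = 0.

Lemma upper_mxD b c : upper_mx b -> upper_mx c -> upper_mx (b + c).
Proof. by move=> ub uc i j ij; rewrite mxE ub ?uc ?addr0. Qed.

Lemma upper_mxM b c : upper_mx b -> upper_mx c -> upper_mx (b *m c).
Proof.
move=> ub uc i j ij; rewrite mxE big1 // => l _.
have [li|il] := ltnP l i; first by rewrite ub ?mul0r.
by rewrite uc ?mulr0 //; apply: leq_trans il.
Qed.

Lemma upper_mx_scalar (a : K) : upper_mx a%:M.
Proof. by move=> i j; rewrite mxE; case: eqP => [->|_ _ //]; rewrite ltnn. Qed.

Lemma strict_upper_upper b : strict_upper_mx b -> upper_mx b.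
Proof. by move=> sb i j /ltnW/sb. Qed.

Lemma strict_upperN b : strict_upper_mx b -> strict_upper_mx (- b).
Proof. by move=> sb i j ij; rewrite mxE sb ?oppr0. Qed.

Lemma upper_det b : upper_mx b -> \det b = \prod_i b i i.
Proof.
move=> ub; rewrite -det_tr det_trig; first by apply: eq_bigr => i _; rewrite mxE.
by apply/is_trig_mxP => i j ij; rewrite mxE ub.
Qed.

Lemma upper_unit b : upper_mx b -> (b \in unitmx) = [forall i, b i i != 0].
Proof.
move=> ub; rewrite unitmxE unitfE upper_det //.
apply/prodf_neq0/forallP => [h i|h i _]; [exact: h|exact: h].
Qed.

Lemma borelP b : borel K n b <-> upper_mx b /\ forall i, b i i != 0.
Proof.
split=> [[bu ub]|[ub bd]]; split=> //; first by apply/forallP; rewrite -upper_unit.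
by rewrite upper_unit //; apply/forallP.
Qed.

Lemma borelM b c : borel K n b -> borel K n c -> borel K n (b *m c).
Proof.
move=> [bu ub] [cu uc]; split; first by rewrite unitmx_mul bu.
exact: upper_mxM.
Qed.

(** The entries of [invmx b] below the diagonal vanish by induction from the
    last row upwards: row [i] of [b *m invmx b = 1] expresses entry [(i, j)]
    through the entries [(l, j)] with [i < l]. *)
Lemma borelV b : borel K n b -> borel K n (invmx b).
Proof.
move=> bB; have [ub bd] := (borelP b).1 bB; have [bu _] := bB.
split; first by rewrite unitmx_inv.
move=> i j; have [d] := ubnP (n - i); elim: d i => // d IHd i le_d ji.
have := congr1 (fun A : 'M_n => A i j) (mulmxV bu).
rewrite !mxE (bigD1 i) //= big1 ?addr0 => [|l li].
  have -> : (i == j) = false by apply: contraTF ji => /eqP ->; rewrite ltnn.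
  by move/eqP; rewrite mulf_eq0 (negPf (bd i)) => /eqP.
have [il|il] := ltnP i l; last by rewrite ub ?mul0r // ltn_neqAle il andbT.
rewrite IHd ?mulr0 //; last exact: ltn_trans il.
by move: (ltn_sub2l (ltn_ord i) il) => /leq_trans; apply.
Qed.

Lemma borel_1D u : strict_upper_mx u -> borel K n (1%:M + u).
Proof.
move=> su; apply/borelP; split.
  by apply: upper_mxD; [exact: upper_mx_scalar|exact: strict_upper_upper].
by move=> i; rewrite !mxE eqxx su // addr0 oner_eq0.
Qed.

Lemma act_invK b U : b \in unitmx -> act (invmx b) (act b U) = U.
Proof. by move=> bu; rewrite act_mulmx mulVmx // act_mx1. Qed.

End Borel.

Definition supported (K : fieldType) (n : nat) (I J : {set 'I_n}) (A : 'M[K]_n) :=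
  forall i j : 'I_n, ~~ ((i \in I) && (j \in J)) -> A i j = 0.

(** * Echelon coordinates of a subspace *)

Section CoordinateFrame.
Variables (K : fieldType) (n k : nat) (jmp : 'I_k -> 'I_n).
Hypothesis jmp_inj : injective jmp.

Definition coord_set : {set 'I_n} := [set jmp r | r in 'I_k].
Definition coord_frame : 'M[K]_(n, k) := \matrix_(i, r) (i == jmp r)%:R.

Local Notation J := coord_set.
Local Notation E := coord_frame.

Lemma tr_coord_frameM l (A : 'M[K]_(n, l)) r j : (E^T *m A) r j = A (jmp r) j.
Proof.
rewrite mxE (bigD1 (jmp r)) //= !mxE eqxx mul1r big1 ?addr0 // => i ir.
by rewrite !mxE (negPf ir) mul0r.
Qed.

Lemma mul_coord_frame l (A : 'M[K]_(l, n)) i r : (A *m E) i r = A i (jmp r).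
Proof.
rewrite mxE (bigD1 (jmp r)) //= !mxE eqxx mulr1 big1 ?addr0 // => j jr.
by rewrite !mxE (negPf jr) mulr0.
Qed.

Lemma tr_coord_frameK : E^T *m E = 1%:M.
Proof. by apply/matrixP => r s; rewrite tr_coord_frameM !mxE (inj_eq jmp_inj). Qed.

Lemma coord_frame_mul l (A : 'M[K]_(k, l)) i j : i \notin J -> (E *m A) i j = 0.
Proof.
move=> iJ; rewrite mxE big1 // => r _; rewrite mxE.
by case: eqP => [ir|]; rewrite ?mul0r //; case/negP: iJ; rewrite ir imset_f.
Qed.

Lemma coord_frame_row l (A : 'M[K]_(k, l)) r j : (E *m A) (jmp r) j = A r j.
Proof.
rewrite mxE (bigD1 r) //= !mxE eqxx mul1r big1 ?addr0 // => s sr.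
by rewrite !mxE (inj_eq jmp_inj) eq_sym (negPf sr) mul0r.
Qed.

Lemma coord_spaceE : coord_space K J = colspan E.
Proof.
rewrite colspan_cols /coord_space /J big_imset /=; last by move=> r s _ _ /jmp_inj.
apply: eq_bigr => r _; congr <[_]>%VS; apply/colP => i.
by rewrite !mxE eqxx andbT.
Qed.

Lemma colspan_coord_frame (M : 'M[K]_n) :
  colspan (M *m E) = (\sum_(j in J) <[col j M]>)%VS.
Proof.
rewrite colspan_cols /J big_imset /=; last by move=> r s _ _ /jmp_inj.
apply: eq_bigr => r _; congr <[_]>%VS; apply/colP => i.
by rewrite mxE mul_coord_frame mxE.
Qed.

Lemma mul_coord_frame_tr_out l (A : 'M[K]_(l, k)) i j :
  j \notin J -> (A *m E^T) i j = 0.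
Proof.
by move=> jJ; rewrite -[A]trmxK -trmx_mul mxE coord_frame_mul.
Qed.

(** The reduced echelon coordinates of [colspan M] with respect to the
    coordinate subspace of [J]: when the rows of [M] in [J] are independent,
    [colspan M] is the graph of a linear map from that subspace to the
    complementary coordinate subspace, encoded as an [n x n] matrix [u]; the
    graph itself is [colspan ((1 + u) E)]. *)
Definition echelon (M : 'M[K]_(n, k)) : 'M[K]_n :=
  (M *m invmx (E^T *m M) - E) *m E^T.

Lemma echelon_supported M : E^T *m M \in unitmx -> supported (~: J) J (echelon M).
Proof.
move=> Mu i j; rewrite negb_and inE negbK => /orP[/imsetP[r _ ->]|jJ].
  rewrite -tr_coord_frameM /echelon mulmxA mulmxBr mulmxA mulmxV // tr_coord_frameK.
  by rewrite subrr mul0mx mxE.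
exact: mul_coord_frame_tr_out.
Qed.

Lemma echelonK M : E^T *m M \in unitmx ->
  (1%:M + echelon M) *m E = M *m invmx (E^T *m M).
Proof.
move=> Mu; rewrite mulmxDl mul1mx -mulmxA tr_coord_frameK mulmx1.
by rewrite addrC subrK.
Qed.

Lemma colspan_echelon M : E^T *m M \in unitmx ->
  colspan ((1%:M + echelon M) *m E) = colspan M.
Proof. by move=> Mu; rewrite echelonK // colspan_mulr_unit // unitmx_inv. Qed.

Lemma supported_frame u : supported (~: J) J u ->
  E^T *m ((1%:M + u) *m E) = 1%:M /\ echelon ((1%:M + u) *m E) = u.
Proof.
move=> su; have E1 : E^T *m ((1%:M + u) *m E) = 1%:M.
  apply/matrixP => r s; rewrite tr_coord_frameM mul_coord_frame !mxE (inj_eq jmp_inj).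
  by rewrite su ?addr0 // !inE imset_f.
split=> //; rewrite /echelon E1 invmx1 mulmx1 [(1%:M + u) *m _]mulmxDl mul1mx addrAC subrr add0r.
apply/matrixP => i j; have [/imsetP[r _ ->]|jJ] := boolP (j \in J).
  by rewrite -[_ *m E^T]trmxK trmx_mul trmxK mxE coord_frame_row mxE mul_coord_frame.
by rewrite mul_coord_frame_tr_out // su // negb_and jJ orbT.
Qed.

Lemma echelon_mulr M g : E^T *m M \in unitmx -> g \in unitmx ->
  echelon (M *m g) = echelon M.
Proof.
move=> Mu gu; rewrite /echelon mulmxA.
have -> : invmx (E^T *m M *m g) = invmx g *m invmx (E^T *m M).
  apply: (can_inj (mulKmx (_ : E^T *m M *m g \in unitmx))); first by rewrite unitmx_mul Mu.
  by rewrite mulmxV ?unitmx_mul ?Mu // !mulmxA mulmxK // mulmxV.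
by rewrite mulmxA mulmxK.
Qed.

(** Such a matrix [v] has square zero, as [J] and its complement are disjoint. *)
Lemma supported_inv (v : 'M[K]_n) : supported (~: J) J v -> (1%:M - v) *m (1%:M + v) = 1%:M.
Proof.
move=> sv; rewrite mulmxBl !mul1mx mulmxDr mulmx1.
have -> : v *m v = 0.
  apply/matrixP => a c; rewrite !mxE big1 // => l _.
  have [lJ|lJ] := boolP (l \in J); last by rewrite sv ?mul0r // (negPf lJ) andbF.
  by rewrite [X in _ * X]sv ?mulr0 // inE lJ.
by rewrite addr0 addrK.
Qed.

(** The inverse [1 - v] of [1 + v] moves the graph back, so that [(1 - v) b]
    preserves the coordinate subspace of [J]. *)
Lemma act_echelon_entries (b v : 'M[K]_n) : supported (~: J) J v ->
  act b (colspan E) = colspan ((1%:M + v) *m E) ->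
  forall i j, i \notin J -> j \in J -> ((1%:M - v) *m b) i j = 0.
Proof.
move=> sv; rewrite act_colspan => eqb i _ iJ /imsetP[r _ ->].
have [C bC] : exists C, b *m E = (1%:M + v) *m E *m C by apply: colspan_sub; rewrite eqb.
rewrite -mul_coord_frame -mulmxA bC !mulmxA.
by rewrite supported_inv // mul1mx coord_frame_mul.
Qed.

(** Right multiplication by the inverse of the block [c] of [b] in the rows and
    columns of [J] does not move the coordinate subspace, and turns this block
    into an identity.  What remains of [b] in the columns of [J] is [1 + u]; its
    entries are those of an upper-triangular matrix off the diagonal. *)
Lemma schubert_normal_form (b : 'M[K]_n) : borel K n b ->
  exists u, [/\ strict_upper_mx u, supported (~: J) J u &
    act b (colspan E) = colspan ((1%:M + u) *m E)].
Proof.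
move=> bB; have [ub bd] := (borelP b).1 bB.
pose c : 'M[K]_n := \matrix_(i, j) (if (i \in J) && (j \in J) then b i j else (i == j)%:R).
have uc : upper_mx c.
  move=> i j ij; rewrite mxE ub //; case: ifP => // _.
  by case: eqP ij => // ->; rewrite ltnn.
have cB : borel K n c.
  by apply/borelP; split=> // i; rewrite mxE eqxx; case: ifP => // _; rewrite oner_eq0.
have cE : c *m E = E *m (E^T *m (b *m E)).
  apply/matrixP => i r; have [/imsetP[s _ ->]|iJ] := boolP (i \in J).
    by rewrite coord_frame_row tr_coord_frameM !mul_coord_frame mxE !imset_f.
  rewrite coord_frame_mul // mul_coord_frame mxE (negPf iJ) /=.
  by case: eqP => // ir; case/negP: iJ; rewrite ir imset_f.
have [cu _] := cB; have [_ uci] := borelV cB.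
have Ebu : E^T *m (b *m E) \in unitmx.
  have : E^T *m (invmx c *m E) *m (E^T *m (b *m E)) = 1%:M.
    by rewrite -mulmxA -(mulmxA _ E) -cE mulKmx // tr_coord_frameK.
  by case/mulmx1_unit.
have cVE : invmx c *m E = E *m invmx (E^T *m (b *m E)).
  apply: (can_inj (mulKmx cu)); rewrite mulKVmx // (mulmxA c) cE -(mulmxA E) mulmxV //.
  by rewrite mulmx1.
exists (echelon (b *m E)); split.
- move=> i j ij; have [/andP[iJ jJ]|] := boolP ((i \in ~: J) && (j \in J)); last first.
    exact: echelon_supported.
  have [r _ jr] := imsetP jJ; rewrite jr -mul_coord_frame /echelon -mulmxA.
  rewrite tr_coord_frameK mulmx1 -mulmxA -cVE mulmxA mxE mul_coord_frame -jr !mxE.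
  have ji : (i == j) = false by apply: contraTF iJ => /eqP ->; rewrite inE jJ.
  rewrite -jr ji oppr0 addr0.
  have := upper_mxM ub uci (i := i) (j := j); rewrite mxE; apply.
  by rewrite ltn_neqAle ij andbT; apply: contraFneq ji => /val_inj ->.
- exact: echelon_supported.
- by rewrite act_colspan colspan_echelon.
Qed.

End CoordinateFrame.

(** * A twisted big cell for pairs of subspaces *)

Section PairChart.
Variables (K : closedFieldType) (n k m : nat).
Variables (jl : 'I_k -> 'I_n) (jm : 'I_m -> 'I_n).
Hypotheses (jl_inj : injective jl) (jm_inj : injective jm).
Local Notation X := (grass2 K n).
Local Notation J := (coord_set jl).
Local Notation J' := (coord_set jm).
Local Notation E := (coord_frame K jl).
Local Notation E' := (coord_frame K jm).

Definition zero_rows : {set 'I_n} := (~: J :&: ~: J')%SET.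
Definition two_cols : {set 'I_n} := (J :&: J')%SET.

(** Index the blocks in the rows or columns of [zero_rows] by 0 and those of
    [two_cols] by 2.  As [b] preserves the coordinate subspace of [J], its
    blocks with row outside [J] and column in [J] vanish.  What is left of the
    block (0,2) of [(1 - v) b (1 + y)], which vanishes too, is the equation
    [(b - v b)_00 y = v_02 b_22].  Hence the block diagonal matrix [c] with
    blocks [(b - v b)_00], [b_22] and an identity conjugates [y] into [v_02];
    it is upper triangular with the diagonal of [b] on the first two blocks,
    because [v] is strictly upper triangular. *)
Lemma slice_conjugacy (b y v : 'M[K]_n) : borel K n b ->
  supported zero_rows two_cols y ->
  strict_upper_mx v -> supported (~: J') J' v ->
  act b (colspan E) = colspan E ->
  act b (colspan ((1%:M + y) *m E')) = colspan ((1%:M + v) *m E') ->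
  exists2 c, borel K n c &
    (\matrix_(i, j) if (i \in zero_rows) && (j \in two_cols) then v i j else 0) =
    c *m y *m invmx c.
Proof.
move=> bB sy uv sv bE bE'; have [ub bd] := (borelP b).1 bB.
have bJ i j : i \notin J -> j \in J -> b i j = 0.
  have s0 : supported (~: J) J (0 : 'M[K]_n) by move=> ? ?; rewrite mxE.
  move=> iJ jJ; have := act_echelon_entries s0 (b := b).
  by rewrite addr0 subr0 !mul1mx; apply.
have bJ' i j : i \notin J' -> j \in J' -> ((1%:M - v) *m b *m (1%:M + y)) i j = 0.
  move=> iJ jJ; rewrite -mulmxA; apply: (act_echelon_entries sv) => //.
  by rewrite -act_mulmx act_colspan.
have uvb : upper_mx ((1%:M - v) *m b).
  apply: upper_mxM => //; apply: upper_mxD; first exact: upper_mx_scalar.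
  exact/strict_upper_upper/strict_upperN.
pose c : 'M[K]_n := \matrix_(i, j)
  (if (i \in zero_rows) && (j \in zero_rows) then ((1%:M - v) *m b) i j
   else if (i \in two_cols) && (j \in two_cols) then b i j else (i == j)%:R).
have cB : borel K n c.
  apply/borelP; split=> [i j ij|i].
    rewrite mxE uvb // ub //; case: ifP => // _; case: ifP => // _.
    by case: eqP ij => // ->; rewrite ltnn.
  rewrite mxE eqxx; case: ifP => _; last by case: ifP => // _; rewrite oner_eq0.
  rewrite mulmxBl mul1mx !mxE big1 ?subr0 // => l _.
  by have [il|li] := ltnP i l; [rewrite ub ?mulr0|rewrite uv ?mul0r].
exists c => //; set w := (\matrix_(i, j) _).
have zt i : i \in zero_rows -> (i \in two_cols) = false.
  by rewrite !inE => /andP[/negPf ->].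
suff -> : c *m y = w *m c by rewrite mulmxK //; have [] := cB.
apply/matrixP => i j; rewrite !mxE.
have [i0|i0] := boolP (i \in zero_rows); last first.
  rewrite !big1 // => l _; first by rewrite mxE (negPf i0) mul0r.
  have [l0|l0] := boolP (l \in zero_rows); last by rewrite sy ?mulr0 // (negPf l0).
  rewrite mxE (negPf i0) (zt _ l0) andbF; case: eqP => [il|]; last by rewrite mul0r.
  by rewrite il l0 in i0.
have [j2|j2] := boolP (j \in two_cols); last first.
  rewrite !big1 // => l _; last by rewrite sy ?mulr0 // (negPf j2) andbF.
  rewrite mxE i0 /=; case: ifP => [l2|]; last by rewrite mul0r.
  rewrite mxE (negPf j2) andbF; have -> : (l \in zero_rows) = false.
    by apply/negP => /zt; rewrite l2.
  by case: eqP j2 => [<-|]; rewrite ?l2 // mulr0.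
transitivity (\sum_l ((1%:M - v) *m b) i l * y l j).
  apply: eq_bigr => l _; have [l0|l0] := boolP (l \in zero_rows).
    by rewrite mxE i0 l0.
  by rewrite sy ?mulr0 // (negPf l0).
have := j2; rewrite inE => /andP[jJ jJ'].
have := i0; rewrite !inE => /andP[iJ iJ'].
have := bJ' _ _ iJ' jJ'; rewrite mulmxDr mulmx1 mxE [X in _ + X]mxE => /eqP.
rewrite addrC addr_eq0 => /eqP ->; rewrite mulmxBl mul1mx mxE bJ // add0r !mxE opprK.
apply: eq_bigr => l _; rewrite mxE i0 /=.
have [l2|] := boolP (l \in two_cols).
  rewrite mxE l2 j2; have -> // : (l \in zero_rows) = false.
  by apply/negP => /zt; rewrite l2.
rewrite inE negb_and mul0r => /orP[lJ|lJ']; first by rewrite bJ ?mulr0.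
by rewrite sv ?mul0r // (negPf lJ') andbF.
Qed.

Definition in_chart (A : 'M[K]_(n, k) * 'M[K]_(n, m)) : Prop :=
  E^T *m A.1 \in unitmx /\
  E'^T *m ((1%:M - echelon jl A.1) *m A.2) \in unitmx.

(** The second subspace is read after the first one has been brought to the
    coordinate subspace by [1 - u].  With this twist an orbit becomes a product
    in the coordinates (see [slice_orbit]), which fails for the product of the
    two big cells with their own coordinates. *)
Definition frame_coords (A : 'M[K]_(n, k) * 'M[K]_(n, m)) : 'M[K]_n * 'M[K]_n :=
  (echelon jl A.1, echelon jm ((1%:M - echelon jl A.1) *m A.2)).

Definition coord_frames (c : 'M[K]_n * 'M[K]_n) : 'M[K]_(n, k) * 'M[K]_(n, m) :=
  ((1%:M + c.1) *m E, (1%:M + c.1) *m (1%:M + c.2) *m E').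

Definition chart : set X :=
  [set p | exists A, span_pair A = p /\ in_chart A].

(** The frame is an arbitrary choice; by [coords_span] it does not matter. *)
Definition coords (p : X) : 'M[K]_n * 'M[K]_n :=
  frame_coords (xget (0, 0) [set A | span_pair A = p /\ in_chart A]).

Lemma span_pair_chart A B : span_pair A = span_pair B -> in_chart A ->
  in_chart B /\ frame_coords A = frame_coords B.
Proof.
case: A B => A1 A2 [B1 B2] [eq1 eq2] [/= u1 u2].
have [g gu A1E] := colspan_frame_eq eq1 u1.
have v1 : E^T *m B1 \in unitmx.
  by move: u1; rewrite A1E mulmxA unitmx_mul => /andP[].
have eE : echelon jl A1 = echelon jl B1 by rewrite A1E echelon_mulr.
rewrite mulmxA in u2; have [h hu A2E] := colspan_frame_eq eq2 u2.
rewrite eE in u2 *.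
have v2 : E'^T *m ((1%:M - echelon jl B1) *m B2) \in unitmx.
  by move: u2; rewrite A2E mulmxA unitmx_mul => /andP[]; rewrite mulmxA.
split; first by split.
by rewrite /frame_coords /= eE A2E mulmxA echelon_mulr.
Qed.

Lemma coords_span A : in_chart A -> coords (span_pair A) = frame_coords A.
Proof.
move=> Ac; rewrite /coords; case: xgetP => [B _ [BA Bc]|/(_ A)[]//].
by have [] := span_pair_chart BA Bc.
Qed.

Lemma coord_framesK c : supported (~: J) J c.1 -> supported (~: J') J' c.2 ->
  in_chart (coord_frames c) /\ frame_coords (coord_frames c) = c.
Proof.
case: c => u v /= su sv; have [u1 uE] := supported_frame jl_inj su.
have [v1 vE] := supported_frame jm_inj sv.
have inv : (1%:M - u) *m ((1%:M + u) *m (1%:M + v) *m E') = (1%:M + v) *m E'.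
  by rewrite !mulmxA (supported_inv su) mul1mx.
rewrite /in_chart /frame_coords /= uE inv u1 v1 vE; split=> //.
by split; exact: unitmx1.
Qed.

Lemma chart_coordsK p : chart p ->
  [/\ supported (~: J) J (coords p).1, supported (~: J') J' (coords p).2 &
    span_pair (coord_frames (coords p)) = p].
Proof.
move=> [A [<- Ac]]; rewrite coords_span //; case: A Ac => A1 A2 [/= u1 u2].
have s1 := echelon_supported jl_inj u1.
split; [exact: s1|exact: echelon_supported|].
rewrite /span_pair /coord_frames /=; congr (_, _); first exact: colspan_echelon.
rewrite -mulmxA -act_colspan colspan_echelon // act_colspan mulmxA.
suff -> : (1%:M + echelon jl A1) *m (1%:M - echelon jl A1) = 1%:M by rewrite mul1mx.
by apply: mulmx1C; exact: (supported_inv s1).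
Qed.

Lemma in_chart_frames A : in_chart A -> frames K n k m A.
Proof.
case: A => A1 A2 [/= u1 u2]; split=> /=; apply/eqP; rewrite eqn_leq rank_leq_col /=.
  by rewrite -{1}(mxrank_unit u1) mxrankM_maxr.
by rewrite -{1}(mxrank_unit u2) mulmxA mxrankM_maxr.
Qed.

(** The ambient space contains pairs of subspaces of all dimensions; the chart
    meets only one component. *)
Lemma chart_frames_dim k' m' (A : 'M[K]_(n, k') * 'M[K]_(n, m')) :
  frames K n k' m' A -> chart (span_pair A) -> k' = k /\ m' = m.
Proof.
move=> [r1 r2] [B [[e1 e2] /in_chart_frames[s1 s2]]]; split.
  by apply/eqP; rewrite -r1 -s1 eqn_leq !colspan_rank_le ?e1.
by apply/eqP; rewrite -r2 -s2 eqn_leq !colspan_rank_le ?e2.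
Qed.

(** Clearing the denominator of [1 - echelon] makes the equations and the
    coordinates of the chart polynomial. *)
Let den (A : 'M[K]_(n, k) * 'M[K]_(n, m)) : K := \det (E^T *m A.1).
Let numer (A : 'M[K]_(n, k) * 'M[K]_(n, m)) : 'M[K]_n :=
  (A.1 *m \adj (E^T *m A.1) - E *m (den A)%:M) *m E^T.
Let shear (A : 'M[K]_(n, k) * 'M[K]_(n, m)) : 'M[K]_(n, m) :=
  ((den A)%:M - numer A) *m A.2.
Let den' A : K := \det (E'^T *m shear A).
Let numer' A : 'M[K]_n :=
  (shear A *m \adj (E'^T *m shear A) - E' *m (den' A)%:M) *m E'^T.

Lemma echelonE l (j : 'I_l -> 'I_n) (M : 'M[K]_(n, l)) :
  let F := coord_frame K j in F^T *m M \in unitmx ->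
  echelon j M = (\det (F^T *m M))^-1 *:
    ((M *m \adj (F^T *m M) - F *m (\det (F^T *m M))%:M) *m F^T).
Proof.
move=> F Fu; rewrite /echelon /invmx Fu scalemxAl scalerBr scalemxAr; congr ((_ - _) *m _).
by rewrite scalemxAr scale_scalar_mx mulVf ?mulmx1 // -unitfE -unitmxE.
Qed.

Lemma in_chartE A : in_chart A <-> den A != 0 /\ den' A != 0.
Proof.
rewrite /in_chart; have [u1|u1] := boolP (E^T *m A.1 \in unitmx); last first.
  split=> [[]//|[]]; rewrite /den -unitfE -unitmxE; by move/negP: u1.
have d0 : den A != 0 by rewrite /den -unitfE -unitmxE.
have shE : shear A = den A *: ((1%:M - echelon jl A.1) *m A.2).
  rewrite scalemxAl scalerBr echelonE // scalerA mulfV // scale1r.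
  by rewrite scalemx1.
rewrite /den' shE -scalemxAr detZ mulf_eq0 negb_or expf_neq0 //=.
by rewrite d0 unitmxE unitfE; split=> [[]|[]].
Qed.

Lemma frame_coordsE A : in_chart A ->
  frame_coords A = ((den A)^-1 *: numer A, (den' A)^-1 *: numer' A).
Proof.
move=> Ac; have [d0 d0'] := (in_chartE A).1 Ac; have [u1 u2] := Ac.
rewrite /frame_coords; congr (_, _); first exact: echelonE.
have shE : shear A = (1%:M - echelon jl A.1) *m A.2 *m (den A)%:M.
  rewrite mul_mx_scalar scalemxAl scalerBr echelonE // scalerA mulfV // scale1r.
  by rewrite scalemx1.
have du : ((den A)%:M : 'M[K]_m) \in unitmx.
  by rewrite unitmxE det_scalar unitfE expf_neq0.
rewrite -(echelon_mulr u2 du) -shE echelonE //.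
by rewrite unitmxE unitfE.
Qed.

Let V := ('M[K]_(n, k) * 'M[K]_(n, m))%type.

Lemma polymx_fst : polymx (fun A : V => A.1).
Proof. exact: (polymx_linear (F := fun A : V => A.1)). Qed.

Lemma polymx_snd : polymx (fun A : V => A.2).
Proof. exact: (polymx_linear (F := fun A : V => A.2)). Qed.

Let den_poly : polyfun den.
Proof.
by apply: polyfun_det; apply: polymxM; [exact: polymx_cst|exact: polymx_fst].
Qed.

Let numer_poly : polymx numer.
Proof.
apply: polymxM; last exact: polymx_cst.
apply: polymxD; last apply: polymxN; apply: polymxM.
- exact: polymx_fst.
- apply: polymx_adj; apply: polymxM; [exact: polymx_cst|exact: polymx_fst].
- exact: polymx_cst.
- exact: polymx_scalar.
Qed.

Let shear_poly : polymx shear.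
Proof.
apply: polymxM; last exact: polymx_snd.
by apply: polymxD; [exact: polymx_scalar|exact: polymxN].
Qed.

Let den'_poly : polyfun den'.
Proof. by apply: polyfun_det; apply: polymxM; [exact: polymx_cst|]. Qed.

Let numer'_poly : polymx numer'.
Proof.
apply: polymxM; last exact: polymx_cst.
apply: polymxD; last apply: polymxN; apply: polymxM => //.
- by apply: polymx_adj; apply: polymxM; [exact: polymx_cst|].
- exact: polymx_cst.
- exact: polymx_scalar.
Qed.

Lemma chart_span A : chart (span_pair A) <-> in_chart A.
Proof. by split=> [[B [/span_pair_chart BA /BA[]]]|Ac]; last by exists A. Qed.

Lemma chart_is_open : sopen chart.
Proof.
move=> k' m'; apply/zariski_openP => A [frA cA].
have [ek em] := chart_frames_dim frA cA; subst k' m'.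
exists (fun B => den B * den' B); split; first exact: polyfunM.
  by apply/mulf_neq0; have [] := (in_chartE A).1 ((chart_span A).1 cA).
move=> B; rewrite mulf_eq0 negb_or => /andP[d d'].
have Bc : in_chart B by apply/in_chartE.
by split; [exact: in_chart_frames|apply/chart_span].
Qed.

Lemma coords_regular i j :
  sregular chart (fun p => (coords p).1 i j) /\
  sregular chart (fun p => (coords p).2 i j).
Proof.
split=> k' m' A [frA cA]; have [ek em] := chart_frames_dim frA cA; subst k' m'.
- exists (fun B => numer B i j), den; split=> //.
    by have [] := (in_chartE A).1 ((chart_span A).1 cA).
  move=> B [_ /chart_span Bc] _.
  rewrite -[LHS]/((coords (span_pair B)).1 i j) coords_span // frame_coordsE //=.
  by rewrite mxE mulrC.
- exists (fun B => numer' B i j), den'; split=> //.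
    by have [] := (in_chartE A).1 ((chart_span A).1 cA).
  move=> B [_ /chart_span Bc] _.
  rewrite -[LHS]/((coords (span_pair B)).2 i j) coords_span // frame_coordsE //=.
  by rewrite mxE mulrC.
Qed.

(** The boolean tells the matrix of the second subspace from that of the first
    one. *)
Definition position := (bool * ('I_n * 'I_n))%type.

Definition entry (c : 'M[K]_n * 'M[K]_n) (a : position) : K :=
  (if a.1 then c.2 else c.1) a.2.1 a.2.2.

Definition chart_positions : {set position} :=
  [set a : position | if a.1 then (a.2.1 \notin J') && (a.2.2 \in J')
             else (a.2.1 \notin J) && (a.2.2 \in J)]%SET.

Lemma entry_ext c d : (forall a, entry c a = entry d a) -> c = d.
Proof.
case: c d => [u v] [u' v'] cd; congr (_, _); apply/matrixP => i j.
  exact: (cd (false, (i, j))).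
exact: (cd (true, (i, j))).
Qed.

Lemma entry_supported c : (forall a, a \notin chart_positions -> entry c a = 0) <->
  supported (~: J) J c.1 /\ supported (~: J') J' c.2.
Proof.
split=> [c0|[s1 s2] [[] [i j]]]; rewrite /entry ?inE /= => *.
- split=> i j; rewrite inE => h.
    by apply: (c0 (false, (i, j))); rewrite inE.
  by apply: (c0 (true, (i, j))); rewrite inE.
- by apply: s2; rewrite inE.
- by apply: s1; rewrite inE.
Qed.

(** The affine space of the coordinates that equal those of [y] off [A] and are
    free on [A], with [y] being zero on [A]. *)
Definition fill (A : {set position}) (y : 'M[K]_n * 'M[K]_n) (x : 'rV[K]_#|A|) :
    'M[K]_n * 'M[K]_n :=
  let f a := entry y a + \sum_r x 0 r * (enum_val r == a)%:R in
  (\matrix_(i, j) f (false, (i, j)), \matrix_(i, j) f (true, (i, j))).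

Definition coord_row (A : {set position}) (p : X) : 'rV[K]_#|A| :=
  \row_r entry (coords p) (enum_val r).

Lemma coord_row_sum (A : {set position}) (p q p' q' : X) :
  (forall a, a \in A -> entry (coords p) a + entry (coords q) a =
    entry (coords p') a + entry (coords q') a) ->
  coord_row A p + coord_row A q = coord_row A p' + coord_row A q'.
Proof.
move=> sumE; apply/rowP => r; rewrite [LHS]mxE [RHS]mxE.
have rE z : coord_row A z 0 r = entry (coords z) (enum_val r) by rewrite mxE.
by rewrite !rE sumE // enum_valP.
Qed.

Section CoordSlice.
Variables (A : {set position}) (y : 'M[K]_n * 'M[K]_n).
Hypothesis A_chart : A \subset chart_positions.
Hypothesis y_chart : forall a, a \notin chart_positions -> entry y a = 0.
Hypothesis y_A : forall a, a \in A -> entry y a = 0.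

Lemma entry_fill x a :
  entry (fill y x) a = entry y a + \sum_r x 0 r * (@enum_val _ (mem A) r == a)%:R.
Proof. by case: a => [[] [i j]]; rewrite /entry /fill /= !mxE. Qed.

Lemma fill_out (x : 'rV[K]_#|A|) a : a \notin A -> entry (fill y x) a = entry y a.
Proof.
move=> aA; rewrite entry_fill big1 ?addr0 // => r _.
case: eqP => [ra|]; last by rewrite mulr0.
by move: aA; rewrite -ra enum_valP.
Qed.

Lemma fill_in (x : 'rV[K]_#|A|) r : entry (fill y x) (enum_val r) = x 0 r.
Proof.
rewrite entry_fill y_A ?enum_valP // add0r (bigD1 r) //= eqxx mulr1 big1 ?addr0 //.
by move=> s sr; rewrite (inj_eq enum_val_inj) (negPf sr) mulr0.
Qed.

Lemma fill_entries c : (forall a, a \notin A -> entry c a = entry y a) ->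
  fill y (\row_(r < #|A|) entry c (enum_val r)) = c.
Proof.
move=> cy; apply: entry_ext => a; have [aA|aA] := boolP (a \in A).
  by rewrite -(enum_rankK_in aA aA) fill_in mxE.
by rewrite fill_out ?cy.
Qed.

Lemma fill_supported (x : 'rV[K]_#|A|) :
  supported (~: J) J (fill y x).1 /\ supported (~: J') J' (fill y x).2.
Proof.
apply/entry_supported => a ac.
by rewrite fill_out ?y_chart //; apply: contra ac => /(fintype.subsetP A_chart).
Qed.

Definition slice_param (x : 'rV[K]_#|A|) := coord_frames (fill y x).

Lemma slice_param_frames x : frames K n k m (slice_param x).
Proof.
apply: in_chart_frames.
by have [s1 s2] := fill_supported x; have [] := coord_framesK s1 s2.
Qed.

Lemma slice_param_poly : polymap slice_param.
Proof.
have pfill a : polyfun (fun x : 'rV[K]_#|A| => entry (fill y x) a).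
  rewrite (_ : (fun _ => _) = fun x : 'rV[K]_#|A| =>
     entry y a + \sum_r x 0 r * (enum_val r == a)%:R); last first.
    by apply/funext => x; rewrite entry_fill.
  apply: polyfunD; first exact: polyfun_cst.
  apply: polyfun_sum => r; apply: polyfunM; last exact: polyfun_cst.
  exact: polyfun_coord.
have p1 : polymx (fun x => 1%:M + (fill (A := A) y x).1).
  apply: polymxD; first exact: polymx_cst.
  by move=> i j; exact: (pfill (false, (i, j))).
have p2 : polymx (fun x => 1%:M + (fill (A := A) y x).2).
  apply: polymxD; first exact: polymx_cst.
  by move=> i j; exact: (pfill (true, (i, j))).
apply: polymap_mx2.
  by apply: polymxM => //; exact: polymx_cst.
by apply: polymxM; [exact: polymxM|exact: polymx_cst].
Qed.

Lemma coord_row_regular (l : {linear 'rV[K]_#|A| -> K^o}) :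
  sregular chart (l \o coord_row A).
Proof.
rewrite (_ : _ \o _ = fun p => \sum_r entry (coords p) (enum_val r) * l (delta_mx 0 r)); last first.
  apply/funext => p; rewrite /= linear_mx_sum big_ord1; apply: eq_bigr => r _.
  by rewrite mxE.
apply: grass2_regular_sum => r; apply: grass2_regularM; last exact: grass2_regular_cst.
rewrite /entry; case: (enum_val r) => [[] [i j]] /=; by have [] := coords_regular i j.
Qed.

Lemma coords_param x : coords (span_pair (slice_param x)) = fill y x.
Proof.
have [s1 s2] := fill_supported x; have [ic fcE] := coord_framesK s1 s2.
by rewrite coords_span.
Qed.

Lemma entry_fill_coord_row p a : entry (fill y (coord_row A p)) a =
  if a \in A then entry (coords p) a else entry y a.
Proof.
case: ifPn => aA; last exact: fill_out.
by rewrite -(enum_rankK_in aA aA) fill_in mxE.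
Qed.

Lemma coord_row_param x : coord_row A (span_pair (slice_param x)) = x.
Proof.
by apply/rowP => r; rewrite mxE coords_param fill_in.
Qed.

Definition coord_slice : set X := range (fun x => span_pair (slice_param x) : X).

Lemma sliceP p :
  coord_slice p <-> chart p /\ forall a, a \notin A -> entry (coords p) a = entry y a.
Proof.
split=> [[x _ <-]|[cp ya]].
  have [s1 s2] := fill_supported x; have [ic fcE] := coord_framesK s1 s2.
  split; first exact/chart_span.
  by move=> a aA; rewrite coords_param fill_out.
exists (coord_row A p) => //; rewrite /slice_param /coord_row fill_entries //.
by have [] := chart_coordsK cp.
Qed.

Lemma slice_chart : coord_slice `<=` chart.
Proof. by move=> p /sliceP[]. Qed.

Lemma slice_iso : isomorphism (K := K) (X := X)
  (Y := affine_space 'rV[K]_#|A|) coord_slice setT (coord_row A).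
Proof.
apply: (chart_iso slice_param_poly slice_param_frames chart_is_open coord_row_regular).
- by [].
- exact: slice_chart.
- by move=> x _; rewrite coord_row_param.
Qed.

Lemma slice_dim : has_dim coord_slice #|A|.
Proof.
apply: (chart_dim slice_param_poly slice_param_frames chart_is_open coord_row_regular).
- by [].
- exact: slice_chart.
- exact: coord_row_param.
Qed.

End CoordSlice.
End PairChart.

(** * Schubert cells, orbits and transversality *)

Section PairOfCells.
Variables (K : closedFieldType) (n k m : nat).
Variables (jl : 'I_k -> 'I_n) (jm : 'I_m -> 'I_n).
Hypotheses (jl_inj : injective jl) (jm_inj : injective jm).
Local Notation X := (grass2 K n).
Local Notation J := (coord_set jl).
Local Notation J' := (coord_set jm).
Local Notation E := (coord_frame K jl).
Local Notation E' := (coord_frame K jm).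
Local Notation position := (position n).
Local Notation zero_rows := (zero_rows jl jm).
Local Notation two_cols := (two_cols jl jm).
Local Notation chart_positions := (chart_positions jl jm).
Local Notation coords := (@coords K n k m jl jm).
Local Notation coord_slice := (@coord_slice K n k m jl jm).

Definition cell_positions : {set position} :=
  [set a in chart_positions | (a.2.1 < a.2.2)%N]%SET.

Definition slice_positions : {set position} :=
  [set a in cell_positions | [&& a.1, a.2.1 \in zero_rows & a.2.2 \in two_cols]]%SET.

Definition min_positions : {set position} := (cell_positions :\: slice_positions)%SET.

Lemma cell_sub_chart : cell_positions \subset chart_positions.
Proof. by apply/fintype.subsetP => a; rewrite inE => /andP[]. Qed.

Lemma slice_sub_cell : slice_positions \subset cell_positions.
Proof. by apply/fintype.subsetP => a; rewrite inE => /andP[]. Qed.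

Lemma min_sub_cell : min_positions \subset cell_positions.
Proof. exact: subsetDl. Qed.

Lemma entry0 (a : position) : entry (0 : 'M[K]_n * 'M[K]_n) a = 0.
Proof. by case: a => [[] [i j]]; rewrite /entry mxE. Qed.

Definition cell (p : X) : Prop :=
  (exists2 b, borel K n b & p.1 = act b (colspan E)) /\
  (exists2 b, borel K n b & p.2 = act b (colspan E')).

Lemma cell_entries (c : 'M[K]_n * 'M[K]_n) :
  (forall a, a \notin cell_positions -> entry c a = 0) <->
  [/\ strict_upper_mx c.1, strict_upper_mx c.2,
    supported (~: J) J c.1 & supported (~: J') J' c.2].
Proof.
split=> [c0|[u1 u2 s1 s2]].
  have c0' a : a \notin chart_positions -> entry c a = 0.
    by move=> ac; apply: c0; rewrite inE (negPf ac).
  have [s1 s2] := (entry_supported jl jm c).1 c0'.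
  split=> // i j ij.
    by apply: (c0 (false, (i, j))); rewrite !inE /= ltnNge ij andbF.
  by apply: (c0 (true, (i, j))); rewrite !inE /= ltnNge ij andbF.
move=> a; rewrite inE negb_and => /orP[ac|]; first exact: (entry_supported jl jm c).2 a ac.
case: a => [[] [i j]]; rewrite /entry /= -leqNgt => ij; [exact: u2|exact: u1].
Qed.

(** Put the first subspace in the form [(1 + u) U0], undo [1 + u], then put the
    second one in the form [(1 + v) W0]; all this happens within the group of
    upper-triangular matrices. *)
Lemma cell_slice : cell = coord_slice cell_positions 0.
Proof.
have sP := sliceP jl_inj jm_inj cell_sub_chart (fun a _ => entry0 a) (fun a _ => entry0 a).
apply/seteqP; split=> [[U W] [/= [b bB UE] [b' bB' WE]]|p].
  have [u [uu su bu]] := schubert_normal_form jl_inj bB.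
  have uN : borel K n (1%:M - u) by apply: borel_1D; apply: strict_upperN.
  have uI : (1%:M + u) *m (1%:M - u) = 1%:M by apply: mulmx1C; exact: (supported_inv su).
  have [v [uv sv bv]] := schubert_normal_form jm_inj (borelM uN bB').
  have -> : (U, W) = span_pair (coord_frames jl jm (u, v)).
    rewrite /span_pair /coord_frames /= -bu UE; congr (_, _).
    by rewrite -mulmxA -act_colspan -bv !act_mulmx mulmxA uI mul1mx WE.
  apply/sP; have [ic fcE] := coord_framesK jl_inj jm_inj (c := (u, v)) su sv.
  split; first exact/chart_span.
  rewrite coords_span // fcE => a ac; rewrite entry0.
  by apply: (cell_entries _).2 ac; split.
move=> /sP[pc p0]; have [s1 s2 <-] := chart_coordsK jl_inj jm_inj pc.
have [u1 u2 _ _] : [/\ strict_upper_mx (coords p).1, strict_upper_mx (coords p).2,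
    supported (~: J) J (coords p).1 & supported (~: J') J' (coords p).2].
  by apply/cell_entries => a /p0 ->; rewrite entry0.
split; rewrite /span_pair /coord_frames /=.
  by exists (1%:M + (coords p).1); [exact: borel_1D|rewrite act_colspan].
exists ((1%:M + (coords p).1) *m (1%:M + (coords p).2)); last by rewrite act_colspan.
by apply: borelM; apply: borel_1D.
Qed.

Lemma sliceE y p :
  (forall a, a \notin slice_positions -> entry y a = 0) ->
  coord_slice min_positions y p <->
  chart jl jm p /\ forall a, a \notin min_positions -> entry (coords p) a = entry y a.
Proof.
move=> y0; apply: sliceP => //.
- exact: fintype.subset_trans min_sub_cell cell_sub_chart.
- move=> a ac; apply: y0; apply: contra ac => /(fintype.subsetP slice_sub_cell).
  exact: (fintype.subsetP cell_sub_chart).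
- by move=> a; rewrite inE => /andP[/y0].
Qed.

(** The points of the slice have the first subspace constant: [1 + y] maps the
    point with the matrix [- y] on the first subspace to this one, so either of
    the two subspaces may carry the matrix. *)
Definition base_point (y : 'M[K]_n) : X := (colspan E, colspan ((1%:M + y) *m E')).

Definition slice_mx (y : 'M[K]_n) : Prop := strict_upper_mx y /\ supported zero_rows two_cols y.

Lemma slice_mx_entries y : slice_mx y <->
  forall a, a \notin slice_positions -> entry (0, y) a = 0.
Proof.
split=> [[uy sy]|y0].
  move=> [[] [i j]] h; rewrite /entry /=; last by rewrite mxE.
  have [/andP[i0 j2]|/sy//] := boolP ((i \in zero_rows) && (j \in two_cols)).
  apply: uy; rewrite leqNgt; apply: contra h => ij.
  rewrite !inE /= ij; move: i0 j2; rewrite !inE.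
  by move=> /andP[-> ->] /andP[-> ->].
have sy : supported zero_rows two_cols y.
  move=> i j ij; apply: (y0 (true, (i, j))); apply: contra ij.
  by rewrite inE => /andP[_ /andP[_]].
split=> // i j ij; apply: (y0 (true, (i, j))).
by rewrite !inE /= (leq_gtF ij) !andbF.
Qed.

Lemma slice_mx_cell y : slice_mx y -> supported (~: J') J' y.
Proof.
move=> [_ sy] i j ij; apply: sy; apply: contra ij.
by rewrite !inE => /andP[/andP[_ ->] /andP[_ ->]].
Qed.

Lemma base_pointE y : base_point y = span_pair (coord_frames jl jm (0, y)).
Proof. by rewrite /span_pair /coord_frames /= addr0 !mul1mx. Qed.

Lemma coords_base_point y : supported (~: J') J' y ->
  chart jl jm (base_point y) /\ coords (base_point y) = (0, y).
Proof.
move=> sy; have s0 : supported (~: J) J (0 : 'M[K]_n) by move=> ? ?; rewrite mxE.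
have [ic fcE] := coord_framesK jl_inj jm_inj (c := (0, y)) s0 sy.
by rewrite base_pointE coords_span //; split=> //; apply/chart_span.
Qed.

Lemma base_sliceP p :
  coord_slice slice_positions 0 p <-> exists2 y, slice_mx y & p = base_point y.
Proof.
have sP := sliceP jl_inj jm_inj (fintype.subset_trans slice_sub_cell cell_sub_chart)
  (fun a _ => entry0 a) (fun a _ => entry0 a).
split=> [/sP[cp c0]|[y ym ->]].
  have c1 : (coords p).1 = 0.
    apply/matrixP => i j; have := c0 (false, (i, j)).
    by rewrite /entry !mxE; apply; rewrite !inE andbF.
  exists (coords p).2.
    apply/slice_mx_entries => -[[] [i j]] h; last by rewrite /entry mxE.
    by have := c0 _ h; rewrite entry0.
  by rewrite base_pointE -c1 -surjective_pairing; have [] := chart_coordsK jl_inj jm_inj cp.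
apply/sP; have [cb cE] := coords_base_point (slice_mx_cell ym).
by split=> // a ha; rewrite cE entry0; apply: (slice_mx_entries y).1.
Qed.

Lemma orbit2_act (p : X) b q : borel K n b ->
  orbit2 q p -> orbit2 q ((act b p.1, act b p.2) : X).
Proof.
by move=> bB [c cB ->]; exists (b *m c); [exact: borelM|rewrite /= !act_mulmx].
Qed.

Lemma orbit2_refl (q : X) : orbit2 q q.
Proof.
exists 1%:M; last by rewrite !act_mx1; case: q.
by rewrite -[1%:M]addr0; apply: borel_1D => i j; rewrite mxE.
Qed.

(** A nonzero entry of [v] in a column of [J] lies in a row of [J], as otherwise
    its row would be in [zero_rows] and its column in [two_cols].  Thus [v] acts
    on the coordinate subspace of [J], with square zero, and [1 + v] is an
    automorphism of it. *)
Lemma act_min_part v : supported (~: J') J' v ->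
  (forall i j, i \in zero_rows -> j \in two_cols -> v i j = 0) ->
  act (1%:M + v) (colspan E) = colspan E.
Proof.
move=> sv v0; rewrite act_colspan.
have vE : v *m E = E *m (E^T *m (v *m E)).
  apply/matrixP => i r; have [/imsetP[s _ ->]|iJ] := boolP (i \in J).
    by rewrite coord_frame_row // tr_coord_frameM.
  rewrite coord_frame_mul // mul_coord_frame.
  have [/andP[iJ' rJ']|] := boolP ((i \in ~: J') && (jl r \in J')); last exact: sv.
  by apply: v0; rewrite !inE ?iJ ?rJ' ?imset_f //; move: iJ'; rewrite inE.
have v2 : E^T *m (v *m E) *m (E^T *m (v *m E)) = 0.
  rewrite -mulmxA -(mulmxA v) -vE (mulmxA v).
  apply/matrixP => r s; rewrite tr_coord_frameM mul_coord_frame !mxE.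
  rewrite big1 // => l _; have [lJ|lJ] := boolP (l \in J').
    by rewrite [X in _ * X]sv ?mulr0 // inE lJ.
  by rewrite sv ?mul0r // (negPf lJ) andbF.
rewrite mulmxDl mul1mx vE -{1}[E]mulmx1 -mulmxDr colspan_mulr_unit //.
have := mulmx1_unit (A := 1%:M + E^T *m (v *m E)) (B := 1%:M - E^T *m (v *m E)).
case=> //; rewrite mulmxDl mul1mx mulmxBr mulmx1 v2 subr0.
by rewrite subrK.
Qed.

(** In [(1 + u) (1 + v)], the first factor sets the coordinates of the first
    subspace, and the second one those of the second subspace outside
    [slice_positions]; as [v *m y = 0], the coordinates [y] stay as they are.
    Orbits in the cell are therefore stable under all translations in the
    coordinates of [min_positions], and transversality follows from this product
    structure. *)
Lemma slice_orbit y : slice_mx y ->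
  coord_slice min_positions (0, y) `<=` orbit2 (base_point y).
Proof.
move=> ym p /(sliceE _ ((slice_mx_entries y).1 ym)) [cp ce].
have [s1 s2 <-] := chart_coordsK jl_inj jm_inj cp.
move: (coords p) ce s1 s2 => c ce s1 s2.
have ce0 a : a \notin cell_positions -> entry c a = 0.
  move=> ac; rewrite ce; first by apply: (slice_mx_entries y).1 => //;
    apply: contra ac => /(fintype.subsetP slice_sub_cell).
  by apply: contra ac => /(fintype.subsetP min_sub_cell).
have [u1 u2 _ _] := (cell_entries c).1 ce0.
pose v := c.2 - y.
have vij i j : v i j = c.2 i j - y i j by rewrite mxE [X in _ + X = _]mxE.
have sv : supported (~: J') J' v.
  by move=> i j ij; rewrite vij s2 // (slice_mx_cell ym) // subrr.
have v0 i j : i \in zero_rows -> j \in two_cols -> v i j = 0.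
  move=> i0 j2; have := ce (true, (i, j)); rewrite /entry /= vij => ->; first by rewrite subrr.
  rewrite !inE negb_and negbK; have [ij|ij] := boolP (i < j)%N; last by rewrite !andbF orbT.
  rewrite [(_ \in _) && _]andbC /=.
  by move: i0 j2; rewrite !inE => /andP[-> ->] /andP[-> ->].
have vy : v *m y = 0.
  apply/matrixP => i j; rewrite !mxE big1 // => l _.
  have [l0|l0] := boolP (l \in zero_rows); last first.
    by have [_ sy] := ym; rewrite [X in _ * X]sy ?mulr0 // (negPf l0).
  rewrite sv ?mul0r // negb_and; move: l0; rewrite !inE => /andP[_ ->].
  by rewrite orbT.
have c2E : c.2 = v + y by rewrite subrK.
clearbody v; exists ((1%:M + c.1) *m (1%:M + v)).
  apply: borelM; apply: borel_1D => // i j ij.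
  by have [uy _] := ym; rewrite vij u2 // uy // subrr.
rewrite /span_pair /coord_frames /=; congr (_, _).
  by rewrite -act_mulmx act_min_part // act_colspan.
rewrite act_colspan c2E -!mulmxA; congr (colspan (_ *m _)).
rewrite mulmxA; congr (_ *m _).
by rewrite mulmxDl mul1mx mulmxDr mulmx1 vy addr0 -addrA [y + _]addrC.
Qed.

(** Nothing but zero is conjugate to zero, so [slice_conjugacy] with [y = 0]
    makes the coordinates at [slice_positions] vanish along the orbit. *)
Lemma min_orbit : orbit2 (base_point 0) = coord_slice min_positions 0.
Proof.
have m0 : slice_mx 0 by split=> i j; rewrite mxE.
apply/seteqP; split=> [p [b bB ->]|]; last exact: slice_orbit.
have [u [uu su bu]] := schubert_normal_form jl_inj bB.
have uN : borel K n (1%:M - u) by apply: borel_1D; apply: strict_upperN.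
have uI : (1%:M + u) *m (1%:M - u) = 1%:M by apply: mulmx1C; exact: (supported_inv su).
have b'B := borelM uN bB.
have [v [uv sv bv]] := schubert_normal_form jm_inj b'B.
have bE : act ((1%:M - u) *m b) (colspan E) = colspan E.
  by rewrite -act_mulmx bu act_colspan mulmxA (supported_inv su) mul1mx.
have [c cB] : exists2 c, borel K n c &
    (\matrix_(i, j) if (i \in zero_rows) && (j \in two_cols) then v i j else 0) =
    c *m 0 *m invmx c.
  apply: slice_conjugacy uv sv bE _ => //; first by move=> ? ?; rewrite mxE.
  by rewrite addr0 mul1mx.
rewrite mulmx0 mul0mx => /matrixP v02.
have -> : (act b (base_point 0).1, act b (base_point 0).2) =
    span_pair (coord_frames jl jm (u, v)) :> X.
  rewrite /span_pair /coord_frames /= addr0 mul1mx bu; congr (_, _).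
  by rewrite -mulmxA -act_colspan -bv !act_mulmx mulmxA uI mul1mx.
apply/sliceE => [a _|]; first exact: entry0.
have [ic fcE] := coord_framesK jl_inj jm_inj (c := (u, v)) su sv.
split; first exact/chart_span.
rewrite coords_span // fcE => a; rewrite entry0 inE negb_and negbK => /orP[|ac].
  case: a => [[] [i j]]; rewrite inE => /andP[_] //= /andP[i0 j2].
  by have := v02 i j; rewrite !mxE i0 j2.
by apply: (cell_entries _).2 ac; split.
Qed.

(** Between two points of the slice, the restriction to [zero_rows] and
    [two_cols] in [slice_conjugacy] loses no entry. *)
Lemma slice_conj_orbit b y z : borel K n b -> slice_mx y -> slice_mx z ->
  act b (base_point y).1 = (base_point z).1 ->
  act b (base_point y).2 = (base_point z).2 ->
  exists2 c, borel K n c & z = c *m y *m invmx c.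
Proof.
move=> bB ym zm b1 b2; have [uz sz] := zm; have [uy sy] := ym.
have [c cB cE] := slice_conjugacy bB sy uz (slice_mx_cell zm) b1 b2.
exists c => //; rewrite -cE; apply/matrixP => i j; rewrite mxE.
by case: ifP => // /negbT/sz.
Qed.

Lemma tangent_sub (A : set X) p D1 D2 :
  tangent_space A p D1 -> tangent_space A p D2 ->
  tangent_space A p (fun f => D1 f - D2 f).
Proof.
move=> [[e1 a1 z1 m1] v1] [[e2 a2 z2 m2] v2]; split; first split.
- by move=> f g rf rg fg; rewrite (e1 f g) // (e2 f g).
- by move=> f g rf rg; rewrite a1 // a2 // opprD addrACA.
- by move=> c f rf; rewrite z1 // z2 // mulrBr.
- by move=> f g rf rg; rewrite m1 // m2 // opprD addrACA -!mulrBr.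
- by move=> f rf f0; rewrite v1 // v2 // subrr.
Qed.

(** The coordinates of the cell split into those at [slice_positions], free
    along the slice, and those at [min_positions], free along the orbit by
    [slice_orbit].  Composing functions with the two coordinate retractions
    through the point splits a tangent vector accordingly; that the two parts
    add up to it is checked on linear functions of the coordinates. *)
Lemma slice_transverse y (q : X) : slice_mx y -> orbit2 q (base_point y) ->
  transverse_at cell (coord_slice slice_positions 0) (orbit2 q) (base_point y).
Proof.
move=> ym qy D tD; have [dD _] := tD; set p := base_point y in dD tD *.
have [pc pE] := coords_base_point (slice_mx_cell ym).
have ye := (slice_mx_entries y).1 ym.
have e0 (a : position) : entry (0 : 'M[K]_n * 'M[K]_n) a = 0 := entry0 a.
have sc := fintype.subset_trans slice_sub_cell cell_sub_chart.
have mc := fintype.subset_trans min_sub_cell cell_sub_chart.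
have yc a : a \notin chart_positions -> entry (0, y) a = 0.
  by move=> ac; apply: ye; apply: contra ac => /(fintype.subsetP sc).
have ymin a : a \in min_positions -> entry (0, y) a = 0.
  by rewrite inE => /andP[/ye].
have c0 : forall a, a \notin chart_positions -> entry (0 : 'M[K]_n * 'M[K]_n) a = 0 by [].
have s0 : forall A : {set position}, forall a, a \in A -> entry (0 : 'M[K]_n * 'M[K]_n) a = 0 by [].
pose phi1 x : X := span_pair (slice_param jl jm (A := slice_positions) 0 x).
pose phi2 x : X := span_pair (slice_param jl jm (A := min_positions) (0, y) x).
pose r1 := coord_row jl jm slice_positions : X -> 'rV[K]_ _.
pose r2 := coord_row jl jm min_positions : X -> 'rV[K]_ _.
pose D1 f := D (f \o phi1 \o r1); pose D2 f := D (f \o phi2 \o r2).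
have co1 := chart_is_open K jl jm.
have ps : coord_slice slice_positions 0 p by apply/base_sliceP; exists y.
have pm : coord_slice min_positions (0, y) p by apply/(sliceE _ ye); rewrite pE.
have fix1 : phi1 (r1 p) = p.
  by case: ps => x _ <-; rewrite /phi1 /r1 (coord_row_param jl_inj jm_inj sc c0 (s0 _)).
have fix2 : phi2 (r2 p) = p.
  by case: pm => x _ <-; rewrite /phi2 /r2 (coord_row_param jl_inj jm_inj mc yc ymin).
have T1 Z : (forall x, Z (phi1 x)) -> tangent_space Z p D1.
  move=> Z1; apply: (retract_tangent (slice_param_poly jl jm _ 0)
    (slice_param_frames jl_inj jm_inj sc c0) co1 (@coord_row_regular K n k m jl jm _)) => //.
have T2 Z : (forall x, Z (phi2 x)) -> tangent_space Z p D2.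
  move=> Z2; apply: (retract_tangent (slice_param_poly jl jm _ (0, y))
    (slice_param_frames jl_inj jm_inj mc yc) co1 (@coord_row_regular K n k m jl jm _)) => //.
exists D1, D2; split.
- by apply: T1 => x; exists x.
- apply: T2 => x; have : coord_slice min_positions (0, y) (phi2 x) by exists x.
  by move=> /(slice_orbit ym) [b bB ->]; exact: orbit2_act.
have T : tangent_space cell p (fun f => D f - D1 f - D2 f).
  apply: tangent_sub; first apply: tangent_sub => //.
  - apply: T1 => x; rewrite cell_slice; apply/(sliceP jl_inj jm_inj cell_sub_chart c0 (s0 _)).
    have : coord_slice slice_positions 0 (phi1 x) by exists x.
    move=> /(sliceP jl_inj jm_inj sc c0 (s0 _))[xc xe]; split=> // a ac; apply: xe.
    by apply: contra ac => /(fintype.subsetP slice_sub_cell).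
  - apply: T2 => x; rewrite cell_slice; apply/(sliceP jl_inj jm_inj cell_sub_chart c0 (s0 _)).
    have : coord_slice min_positions (0, y) (phi2 x) by exists x.
    move=> /(sliceE _ ye)[xc xe]; split=> // a ac; rewrite xe ?ye ?e0 //.
      by apply: contra ac => /(fintype.subsetP slice_sub_cell).
    by apply: contra ac => /(fintype.subsetP min_sub_cell).
move=> f rf; apply/eqP; rewrite -subr_eq0 opprD addrA; apply/eqP.
have cp : cell p by case: tD => _ _; rewrite cell_slice;
  apply/(sliceP jl_inj jm_inj cell_sub_chart c0 (s0 _)); split=> // a ac;
  rewrite pE ye ?e0 //; apply: contra ac => /(fintype.subsetP slice_sub_cell).
apply: (tangent_vector_eq0 (slice_param_poly jl jm _ 0)
  (slice_param_frames jl_inj jm_inj cell_sub_chart c0) co1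
  (@coord_row_regular K n k m jl jm cell_positions)) T _ _ rf => //.
- exact: cell_slice.
- by rewrite cell_slice => q' /(sliceP jl_inj jm_inj cell_sub_chart c0 (s0 _))[].
- exact: (coord_row_param jl_inj jm_inj cell_sub_chart c0 (s0 _)).
move=> l; set r := coord_row jl jm cell_positions.
have rl : regular_at p (l \o r).
  by exists (chart jl jm); split=> //; exact: coord_row_regular.
have rl1 : regular_at p ((l \o r) \o phi1 \o r1).
  apply: (retract_regular (slice_param_poly jl jm _ 0)
    (slice_param_frames jl_inj jm_inj sc c0) co1 (@coord_row_regular K n k m jl jm _)) => //.
have rl2 : regular_at p ((l \o r) \o phi2 \o r2).
  apply: (retract_regular (slice_param_poly jl jm _ (0, y))
    (slice_param_frames jl_inj jm_inj mc yc) co1 (@coord_row_regular K n k m jl jm _)) => //.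
have rc : regular_at p (fun=> l (r p) : K).
  by exists (chart jl jm); split=> //; exact: grass2_regular_cst.
have [Dext DD _ _] := dD.
have l_sum x x' z z' : x + x' = z + z' -> l x + l x' = l z + l z'.
  by move=> xz; rewrite -!linearD xz.
suff : D (l \o r) + D (fun=> l (r p)) = D1 (l \o r) + D2 (l \o r).
  by rewrite (derivation_cst _ co1 pc dD) addr0 => ->; rewrite addrAC addrK subrr.
rewrite -(DD _ _ rl rc) -(DD _ _ rl1 rl2).
apply: Dext; [exact: regular_atD|exact: regular_atD|].
exists (chart jl jm); split; [exact: co1|exact: pc|move=> q' _].
rewrite -[LHS]/(l (r q') + l (r p)) -[RHS]/(l (r (phi1 (r1 q'))) + l (r (phi2 (r2 q')))).
apply: l_sum; apply: coord_row_sum => a aC.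
rewrite (coords_param jl_inj jm_inj sc c0) (coords_param jl_inj jm_inj mc yc).
rewrite (entry_fill_coord_row _ _ (s0 _)) (entry_fill_coord_row _ _ ymin) pE e0.
rewrite [in X in _ = _ + X]inE aC andbT.
case: ifPn => sS /=; first by [].
by rewrite add0r ye // addr0.
Qed.

End PairOfCells.

(** * The slice as a variety of matrices *)

Section SliceEmbedding.
Variables (K : closedFieldType) (n k m : nat).
Variables (jl : 'I_k -> 'I_n) (jm : 'I_m -> 'I_n).
Hypotheses (jl_inj : injective jl) (jm_inj : injective jm).
Local Notation X := (grass2 K n).
Local Notation J := (coord_set jl).
Local Notation position := (position n).
Local Notation slice_positions := (slice_positions jl jm).
Local Notation min_positions := (min_positions jl jm).
Local Notation cell_positions := (cell_positions jl jm).
Local Notation slice_mx := (@slice_mx K n k m jl jm).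
Local Notation base_point := (@base_point K n k m jl jm).
Local Notation coords := (@coords K n k m jl jm).

Definition transversal_slice : set X := coord_slice jl jm slice_positions 0.

Let sc : slice_positions \subset chart_positions jl jm :=
  fintype.subset_trans (slice_sub_cell jl jm) (cell_sub_chart jl jm).

Lemma transversal_slice_iso : isomorphism (K := K) (X := X)
  (Y := affine_space 'rV[K]_#|slice_positions|) transversal_slice setT
  (coord_row jl jm slice_positions).
Proof. by apply: slice_iso => // a _; exact: entry0. Qed.

Lemma cell_dim : has_dim (@cell K n k m jl jm) #|cell_positions|.
Proof.
rewrite cell_slice //; apply: slice_dim => //; first exact: cell_sub_chart.
  by move=> a _; exact: entry0.
by move=> a _; exact: entry0.
Qed.

Lemma min_orbit_dim : has_dim (orbit2 (base_point 0)) #|min_positions|.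
Proof.
rewrite min_orbit //; apply: slice_dim => //.
- exact: fintype.subset_trans (min_sub_cell jl jm) (cell_sub_chart jl jm).
- by move=> a _; exact: entry0.
- by move=> a _; exact: entry0.
Qed.

Lemma card_cell_positions :
  #|cell_positions| = (#|min_positions| + #|slice_positions|)%N.
Proof.
rewrite addnC -(cardsID slice_positions cell_positions); congr (_ + _)%N.
by apply: eq_card => a; rewrite inE; case: (boolP (a \in slice_positions));
  rewrite ?andbF // => /(fintype.subsetP (slice_sub_cell jl jm)) ->.
Qed.

Lemma transversal_slice_locally_closed : locally_closed transversal_slice.
Proof.
pose A := [set: position]%SET; pose r := coord_row jl jm A : X -> 'rV[K]_#|A|.
pose W : set 'rV[K]_#|A| := [set x |
  exists2 s, @enum_val _ (mem A) s \notin slice_positions & x 0 s != 0].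
have oW : zariski_open W.
  apply/zariski_openP => x [s sS xs]; exists (fun x : 'rV[K]_#|A| => x 0 s); split=> //.
    exact: polyfun_coord.
  by move=> z zs; exists s.
exists (chart jl jm), (chart jl jm `&` r @^-1` W); split.
- exact: chart_is_open.
- by apply: (chart_open (chart_is_open K jl jm) _ oW) => l; apply: coord_row_regular.
have sP := sliceP jl_inj jm_inj sc (fun a _ => entry0 K a) (fun a _ => entry0 K a).
apply/seteqP; split=> p; first move=> /sP[pc pe].
  split=> // -[_ [s sS]]; rewrite mxE pe //; last by rewrite entry0 eqxx.
move=> [pc pW]; apply/sP; split=> // a aS; rewrite entry0.
apply/eqP/negPn/negP => pa; apply: pW; split=> //.
have aA : a \in A by rewrite inE.
by exists (enum_rank_in aA a); rewrite ?mxE enum_rankK_in.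
Qed.

(** The representatives of the orbits carry their matrix on the first subspace,
    the points of the slice on the second one; passing from one to the other
    inverts [1 + y], whence the sign. *)
Definition slice_matrix (p : X) : affine_space 'M[K]_n := - (coords p).2.

Lemma slice_mxN y : slice_mx y -> slice_mx (- y).
Proof.
move=> [uy sy]; split; first exact: strict_upperN.
by move=> i j ij; rewrite mxE sy // oppr0.
Qed.

Lemma slice_matrix_base y : slice_mx y -> slice_matrix (base_point y) = - y.
Proof.
move=> ym; rewrite /slice_matrix.
by have [_ ->] := coords_base_point jl_inj jm_inj (slice_mx_cell ym).
Qed.

Lemma slice_mx_square y : slice_mx y -> y *m y = 0.
Proof.
move=> [_ sy]; apply/matrixP => i j; rewrite !mxE big1 // => l _.
have [l0|l0] := boolP (l \in zero_rows jl jm); last first.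
  by rewrite [X in _ * X]sy ?mulr0 // (negPf l0).
rewrite sy ?mul0r // negb_and; move: l0; rewrite !inE => /andP[/negPf -> _].
by rewrite orbT.
Qed.

Lemma slice_embedding : embedding transversal_slice (nilp2 K n) slice_matrix.
Proof.
exists [set M : 'M[K]_n | slice_mx M]; split.
- by move=> M Mm; split; [case: Mm|exact: slice_mx_square].
- exists setT, [set M : 'M[K]_n | exists2 ij : 'I_n * 'I_n,
    (true, ij) \notin slice_positions & M ij.1 ij.2 != 0]; split.
  + by apply/zariski_openP => M _; exists (fun=> 1); split; rewrite ?oner_eq0 //; exact: polyfun_cst.
  + apply/zariski_openP => M [[i j] ijS Mij]; exists (fun M : 'M[K]_n => M i j).
    split=> //; last by move=> N Nij; exists (i, j).
    by apply: (polymx_linear (F := fun M : 'M[K]_n => M)).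
  + apply/seteqP; split=> [M /= /slice_mx_entries Mm|M [_ Mm]].
      by split=> // -[[i j] /Mm]; rewrite /entry /= => ->; rewrite eqxx.
    apply/slice_mx_entries => -[[] ij] h; rewrite /entry /=; last by rewrite mxE.
    by apply/eqP/negPn/negP => Mij; apply: Mm; exists ij.
(* The inverse of the embedding has to be defined, and polynomial, on all
   matrices: the entries that do not belong to the slice are discarded. *)
pose mask (M : 'M[K]_n) : 'M[K]_n :=
  \matrix_(i, j) (((true, (i, j)) \in slice_positions)%:R * M i j).
have mask_mx M : slice_mx (mask M).
  apply/slice_mx_entries => -[[] [i j]] h; rewrite /entry mxE //.
  by rewrite (negPf h) mul0r.
have maskK M : slice_mx M -> mask M = M.
  move=> /slice_mx_entries Mm; apply/matrixP => i j; rewrite mxE.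
  case: (boolP (_ \in _)) => [_|/Mm]; first by rewrite mul1r.
  by rewrite /entry /= => ->; rewrite mulr0.
pose F (M : 'M[K]_n) := coord_frames jl jm (0, - mask M).
have FE M : span_pair (F M) = base_point (- mask M) by rewrite base_pointE.
have s0 : supported (~: J) J (0 : 'M[K]_n) by move=> ? ?; rewrite mxE.
have poly_mask : polymx mask.
  move=> i j; rewrite (_ : (fun _ => _) = fun M : 'M[K]_n =>
    ((true, (i, j)) \in slice_positions)%:R * M i j).
    apply: polyfunM; first exact: polyfun_cst.
    exact: (polymx_linear (F := fun M : 'M[K]_n => M)).
  by apply/funext => M; rewrite mxE.
have F_poly : polymap F.
  apply: polymap_mx2; first exact: (polymx_cst _ ((1%:M + 0) *m coord_frame K jl)).
  apply: (@polymxM _ _ _ _ _ (fun M => (1%:M + 0) *m (1%:M - mask M))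
    (fun=> coord_frame K jm)); last exact: polymx_cst.
  apply: polymxM; first exact: polymx_cst.
  by apply: polymxD; [exact: polymx_cst|exact: polymxN].
have F_frames M : frames K n k m (F M).
  apply: (@in_chart_frames _ _ _ _ jl jm); have sy := slice_mx_cell (slice_mxN (mask_mx M)).
  by have [] := coord_framesK jl_inj jm_inj (c := (0, - mask M)) s0 sy.
apply: (chart_iso F_poly F_frames (chart_is_open K jl jm)).
- move=> l; rewrite (_ : _ \o _ = fun p => \sum_i \sum_j (coords p).2 i j * (- l (delta_mx i j))).
    apply: grass2_regular_sum => i; apply: grass2_regular_sum => j.
    apply: grass2_regularM; last exact: grass2_regular_cst.
    by have [] := coords_regular K jl jm i j.
  apply/funext => p; rewrite /= linear_mx_sum; apply: eq_bigr => i _.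
  by apply: eq_bigr => j _; rewrite /slice_matrix mxE mulrN mulNr.
- apply/seteqP; split=> [p /base_sliceP[//|//|y ym ->]|_ [M /= Mm <-]].
    exists (- y); first exact: slice_mxN.
    by rewrite FE (maskK _ (slice_mxN ym)) opprK.
  by rewrite FE; apply/base_sliceP => //; exists (- mask M) => //; apply: slice_mxN.
- move=> p ps; have sP := sliceP jl_inj jm_inj sc (fun a _ => entry0 K a) (fun a _ => entry0 K a).
  by have [] := (sP p).1 ps.
- move=> M Mm; rewrite FE slice_matrix_base; last exact: slice_mxN.
  by rewrite opprK maskK.
Qed.

End SliceEmbedding.

(** * Partitions and their jumps *)

Section Jumps.
Variables (n k : nat) (la : k.-tuple nat).
Hypotheses (hk : (k <= n)%N) (hla : partition_in n la).

Lemma jump_bound (r : 'I_k) : (tnth la (rev_ord r) + r < n)%N.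
Proof.
have [_ /allP/(_ _ (mem_tnth (rev_ord r) la)) le] := hla.
apply: leq_ltn_trans (leq_add le (leqnn r)) _.
by rewrite -{2}(subnK hk) ltn_add2l.
Qed.

Definition jump (r : 'I_k) : 'I_n := Ordinal (jump_bound r).

Lemma jump_inj : injective jump.
Proof.
have mono (r s : 'I_k) : (r < s)%N -> (jump r < jump s)%N.
  move=> rs; rewrite /= -addnS; apply: leq_add => //.
  have [srt _] := hla; rewrite !(tnth_nth 0%N).
  have tr : transitive geq by move=> a b c /= ba ac; apply: leq_trans ac ba.
  have := sorted_leq_nth tr (fun x => leqnn x) 0%N srt (rev_ord s) (rev_ord r).
  rewrite !inE !size_tuple !ltn_ord /=; apply=> //.
  by apply: leq_sub2l; apply: ltnW.
move=> r s /(congr1 val) /= eqrs; apply: val_inj; apply/eqP.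
by case: (ltngtP r s) => // /mono; rewrite /= eqrs ltnn.
Qed.

Lemma jumps_coord_set : jumps n la = coord_set jump.
Proof.
apply/setP => i; rewrite inE; apply/existsP/imsetP => [[r /eqP ir]|[r _ ->]].
  by exists r => //; apply: val_inj.
by exists r.
Qed.

End Jumps.

(** * Representatives of the orbits *)

Section OrbitRepresentatives.
Variables (K : closedFieldType) (n k m : nat).
Variables (la : k.-tuple nat) (mu : m.-tuple nat).
Hypotheses (hk : (k <= n)%N) (hm : (m <= n)%N).
Hypotheses (hla : partition_in n la) (hmu : partition_in n mu).
Local Notation X := (grass2 K n).
Local Notation jl := (jump hk hla).
Local Notation jm := (jump hm hmu).
Local Notation E := (coord_frame K jl).
Local Notation slice_positions := (slice_positions jl jm).
Local Notation slice_mx := (@slice_mx K n k m jl jm).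
Local Notation base_point := (@base_point K n k m jl jm).

Lemma s_sum_eq0 i : (s_sum la mu i == 0%N) = (i \in zero_rows jl jm).
Proof.
rewrite /s_sum (jumps_coord_set hk hla) (jumps_coord_set hm hmu) !inE.
by case: (i \in _); case: (i \in _).
Qed.

Lemma s_sum_eq2 i : (s_sum la mu i == 2%N) = (i \in two_cols jl jm).
Proof.
rewrite /s_sum (jumps_coord_set hk hla) (jumps_coord_set hm hmu) !inE.
by case: (i \in _); case: (i \in _).
Qed.

Lemma slice_positionsE (b : bool) i j : ((b, (i, j)) \in slice_positions) =
  [&& b, (i < j)%N, i \in zero_rows jl jm & j \in two_cols jl jm].
Proof.
rewrite !inE; case: b => /=; last by rewrite andbF.
by move: (i \in coord_set jl) (i \in coord_set jm) (j \in coord_set jl)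
  (j \in coord_set jm) (i < j)%N => [] [] [] [] [].
Qed.

Lemma dId_card : dId n la mu = #|slice_positions|.
Proof.
have inj : injective (pair true : 'I_n * 'I_n -> position n) by move=> x y [].
rewrite /dId -(card_imset _ inj).
apply: eq_card => -[b [i j]]; rewrite slice_positionsE; apply/imsetP/and4P.
  move=> [[i' j']]; rewrite inE /= s_sum_eq0 s_sum_eq2 => /and3P[ij i0 j2] [-> -> ->].
  by split.
case: b => [[_ ij i0 j2]|[]//]; exists (i, j) => //.
by rewrite inE /= s_sum_eq0 s_sum_eq2 ij i0 j2.
Qed.

Lemma cell2E : cell2 K n la mu = @cell K n k m jl jm.
Proof.
by rewrite /cell2 /cell /schubert_cell (jumps_coord_set hk hla) (jumps_coord_set hm hmu)
  !coord_spaceE //; exact: jump_inj.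
Qed.

Lemma upper_part_slice w : inv_set la mu w -> slice_mx (upper_part K w).
Proof.
move=> [_ wP]; split=> i j; rewrite mxE.
  by move=> ij; rewrite (leq_gtF ij) andbF.
move=> ij; case: andP => // -[/eqP wij ltij]; case/negP: ij.
by have [i0 j2] := wP _ _ ltij wij; rewrite -s_sum_eq0 -s_sum_eq2 i0 j2.
Qed.

(** A jump [j] of [la] moved by [w] satisfies [w j < j], as otherwise the
    condition on [w] at the pair [(j, w j)] would exclude [j] from the jumps;
    hence only the strictly upper part of [w] enters the representative. *)
Lemma orbit_repE w : inv_set la mu w ->
  orbit_rep K la w = act (1%:M + upper_part K w) (colspan E).
Proof.
move=> wI; have [w2 wP] := wI; have ww i : w (w i) = i.
  by have := congr1 (fun s : 'S_n => s i) w2; rewrite permM perm1.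
rewrite act_colspan colspan_coord_frame; last exact: jump_inj.
rewrite /orbit_rep (jumps_coord_set hk hla) [RHS](bigID (fun j => w j == j)) /=.
congr (_ + _)%VS; apply: eq_bigr => j /andP[jJ wj]; congr <[_]>%VS; apply/colP => i.
  rewrite !mxE eqxx andbT; case: (eqVneq (w i) j) => [wij|_]; last by rewrite addr0.
  rewrite -(perm_inj (etrans wij (esym (eqP wj)))) eqxx ltnn addr0 //.
have wjj : (w j < j)%N.
  rewrite ltn_neqAle wj leqNgt; apply/negP => ltj.
  have [/eqP] := wP j (w j) ltj erefl.
  by rewrite s_sum_eq0 !inE jJ.
rewrite !mxE eqxx !andbT addrC; congr (_ + _%:R).
have [wij|wij] := eqVneq (w i) j.
  by have iE : i = w j by [rewrite -wij ww]; rewrite iE eqxx wjj.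
by case: eqVneq => // iw; move: wij; rewrite iw ww eqxx.
Qed.

(** Acting by the inverse of [1 + upper_part w] moves the representative of the
    orbit into the slice. *)
Lemma orbit_w_base w : inv_set la mu w ->
  orbit_w K la mu w = orbit2 ((act (1%:M + upper_part K w) (base_point (- upper_part K w)).1,
    act (1%:M + upper_part K w) (base_point (- upper_part K w)).2) : X).
Proof.
move=> wI; rewrite /orbit_w orbit_repE // (jumps_coord_set hm hmu).
rewrite coord_spaceE; last exact: jump_inj.
congr (orbit2 (_, _)); rewrite /base_point /= act_colspan mulmxA.
have sw := slice_mx_cell (upper_part_slice wI).
by rewrite (mulmx1C (supported_inv sw)) mul1mx.
Qed.

End OrbitRepresentatives.

(** * The slice theorem *)

Section TransversalSlice.
Variables (K : closedFieldType) (n k m : nat).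
Variables (la : k.-tuple nat) (mu : m.-tuple nat).
Hypotheses (hk : (k <= n)%N) (hm : (m <= n)%N).
Hypotheses (hla : partition_in n la) (hmu : partition_in n mu).
Local Notation X := (grass2 K n).
Local Notation jl := (jump hk hla).
Local Notation jm := (jump hm hmu).
Local Notation slice_mx := (@slice_mx K n k m jl jm).
Local Notation base_point := (@base_point K n k m jl jm).
Local Notation transversal_slice := (@transversal_slice K n k m jl jm).

Let il : injective jl := @jump_inj n k la hk hla.
Let im : injective jm := @jump_inj n m mu hm hmu.

Lemma inv_set1 : inv_set la mu (1%g : 'S_n).
Proof.
split; first by rewrite mulg1.
by move=> i j ij; rewrite perm1 => eij; rewrite eij ltnn in ij.
Qed.

Lemma orbit_w1 : orbit_w K la mu (1%g : 'S_n) = orbit2 (base_point 0).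
Proof.
rewrite (orbit_w_base K hk hm hla hmu inv_set1).
have -> : upper_part K (1%g : 'S_n) = 0.
  apply/matrixP => i j; rewrite !mxE perm1.
  by case: eqP => [->|]; rewrite ?ltnn.
by rewrite oppr0 addr0 !act_mx1; congr orbit2; case: (base_point 0).
Qed.

Lemma transversal_sliceP p : transversal_slice p <-> exists2 y, slice_mx y & p = base_point y.
Proof. exact: (base_sliceP il im). Qed.

Lemma transversal_slice_sub : transversal_slice `<=` cell2 K n la mu.
Proof.
rewrite (cell2E K hk hm hla hmu) => p /transversal_sliceP[y [uy _] ->]; split=> /=.
  exists 1%:M; last by rewrite act_mx1.
  by rewrite -[1%:M]addr0; apply: borel_1D => i j _; rewrite mxE.
by exists (1%:M + y); [exact: borel_1D|rewrite act_colspan].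
Qed.

Lemma orbit_w_slice (w : 'S_n) (p : X) : inv_set la mu w ->
  orbit_w K la mu w p -> transversal_slice p ->
  conj_orbit (upper_part K w) (slice_matrix jl jm p).
Proof.
move=> wI; rewrite (orbit_w_base K hk hm hla hmu wI) => -[b bB pE] /transversal_sliceP[y ym py].
have wm := upper_part_slice K hk hm hla hmu wI.
have [uw _] := wm.
have [c cB yE] : exists2 c, borel K n c & y = c *m (- upper_part K w) *m invmx c.
  apply: (slice_conj_orbit (borelM bB (borel_1D uw)) (slice_mxN wm) ym).
    by rewrite -act_mulmx -py pE.
  by rewrite -act_mulmx -py pE.
exists c => //; rewrite py slice_matrix_base //.
by rewrite {1}yE mulmxN mulNmx opprK.
Qed.

Lemma slice_meets_orbit (w : 'S_n) : inv_set la mu w ->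
  transversal_slice (base_point (- upper_part K w)) /\
  orbit_w K la mu w (base_point (- upper_part K w)).
Proof.
move=> wI; have wm := upper_part_slice K hk hm hla hmu wI; split.
  by apply/transversal_sliceP; exists (- upper_part K w) => //; apply: slice_mxN.
rewrite (orbit_w_base K hk hm hla hmu wI); have [uw _] := wm.
have wB := borel_1D uw; exists (invmx (1%:M + upper_part K w)); first exact: borelV.
by have [wu _] := wB; rewrite !act_invK //; case: (base_point _).
Qed.

Lemma slice_min_orbit :
  transversal_slice `&` orbit_w K la mu (1%g : 'S_n) = [set base_point 0].
Proof.
have m0 : slice_mx 0 by split=> i j *; rewrite mxE.
rewrite orbit_w1; apply/seteqP; split=> [p [/transversal_sliceP[y ym ->] [b bB E0]]|_ ->].
  have [c cB ->] : exists2 c, borel K n c & y = c *m 0 *m invmx c.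
    apply: (slice_conj_orbit bB m0 ym).
      by rewrite E0.
    by rewrite E0.
  by rewrite mulmx0 mul0mx.
by split; [apply/transversal_sliceP; exists 0|exact: orbit2_refl].
Qed.

Lemma slice_theorem :
  exists S : set X,
    [/\ S `<=` cell2 K n la mu /\ locally_closed S,
        isomorphic S ([set: 'rV[K]_(dId n la mu)]
             : set (affine_space 'rV[K]_(dId n la mu))) /\
        has_codim (orbit_w K la mu (1%g : 'S_n)) (cell2 K n la mu) (dId n la mu),
        [/\ forall w : 'S_n, inv_set la mu w ->
              S `&` zclosure (orbit_w K la mu w) !=set0,
            forall q : X, cell2 K n la mu q -> forall p, S p -> orbit2 q p ->
                transverse_at (cell2 K n la mu) S (orbit2 q) p &
            exists p, S `&` orbit_w K la mu (1%g : 'S_n) = [set p]] &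
        exists iota : X -> affine_space 'M[K]_n,
          embedding S (nilp2 K n) iota /\
          forall w : 'S_n, inv_set la mu w ->
            iota @` (orbit_w K la mu w `&` S) `<=` conj_orbit (upper_part K w)].
Proof.
exists transversal_slice; split.
- by split; [exact: transversal_slice_sub|exact: transversal_slice_locally_closed].
- rewrite (dId_card hk hm hla hmu); split.
    by exists (coord_row jl jm (slice_positions jl jm)); exact: transversal_slice_iso.
  exists #|cell_positions jl jm|, #|min_positions jl jm|; split.
  + by rewrite (cell2E K hk hm hla hmu); exact: cell_dim.
  + by rewrite orbit_w1; exact: min_orbit_dim.
  + exact: card_cell_positions.
- split.
  + move=> w wI; have [Sp wp] := slice_meets_orbit wI.
    eexists; split; first exact: Sp.
    by move=> U _ Up; eexists; split; [exact: Up|].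
  + move=> q _ p /transversal_sliceP[y ym ->] qp; rewrite (cell2E K hk hm hla hmu).
    exact: slice_transverse.
  + by exists (base_point 0); exact: slice_min_orbit.
- exists (slice_matrix jl jm); split; first exact: slice_embedding.
  by move=> w wI _ [p [wp Sp] <-]; exact: orbit_w_slice.
Qed.

End TransversalSlice.

Theorem lemma4p1 (R : realType) (n k m : nat)
    (la : k.-tuple nat) (mu : m.-tuple nat)
    (hn : (1 <= n)%N) (hk : (k <= n)%N) (hm : (m <= n)%N)
    (hla : partition_in n la) (hmu : partition_in n mu) :
  exists S : set (grass2 R[i] n),
    [/\ S `<=` cell2 R[i] n la mu /\ locally_closed S,
        (* (i) *)
        isomorphic S
          ([set: 'rV[R[i]]_(dId n la mu)]
             : set (affine_space 'rV[R[i]]_(dId n la mu))) /\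
        has_codim (orbit_w R[i] la mu (1%g : 'S_n)) (cell2 R[i] n la mu)
          (dId n la mu),
        (* (ii) *)
        [/\ forall w : 'S_n, inv_set la mu w ->
              S `&` zclosure (orbit_w R[i] la mu w) !=set0,
            forall q : grass2 R[i] n, cell2 R[i] n la mu q ->
              forall p, S p -> orbit2 q p ->
                transverse_at (cell2 R[i] n la mu) S (orbit2 q) p &
            exists p, S `&` orbit_w R[i] la mu (1%g : 'S_n) = [set p]] &
        (* (iii) *)
        exists iota : grass2 R[i] n -> affine_space 'M[R[i]]_n,
          embedding S (nilp2 R[i] n) iota /\
          forall w : 'S_n, inv_set la mu w ->
            iota @` (orbit_w R[i] la mu w `&` S)
              `<=` conj_orbit (upper_part R[i] w)].
Proof. exact: (@slice_theorem R[i] n k m la mu hk hm hla hmu). Qed.
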